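(* For every valid function $p=p(n)$, the performance ratio of \textsc{greedy} on $G(n,n,p)$ satisfies: (i) $\mathcal{R}_{\mathrm{G}}(p(n)) = 1$ if $p(n)=o(1/n)$; (ii) $\displaystyle \mathcal{R}_{\mathrm{G}}(p(n)) \ge \frac{c-\log(2-e^{-c})}{2c-(\gamma^*+\gamma_*+\gamma^*\gamma_* )}$ if $p(n)=c/n$ for a constant $c>0$; (iii) $\mathcal{R}_{\mathrm{G}}(p(n)) = 1$ if $p(n)=\omega(1/n)$.
   Context: For a positive integer $n$ and $p\in(0,1)$, $G(n,n,p)$ is the random bipartite graph with a set $I$ of $n$ ''bins'' and a set $J$ of $n$ ''balls'', each pair $(i,j)\in I\times J$ being an edge independently with probability $p$. Online model: balls arrive one at a time; when ball $j$ arrives its neighboring bins are revealed and the algorithm must immediately and irrevocably match $j$ to an unmatched bin or drop it; each bin is matched at most once. The matching size is the number of matched balls. The \textsc{greedy} algorithm: when ball $j$ arrives, let $U(j)$ be the set of unmatched neighboring bins; if $U(j)\ne\emptyset$ match $j$ to a uniformly random bin of $U(j)$, otherwise drop $j$. A function $p(n)$ is valid if for all $n>0$ it is monotonic in $n$ and satisfies $0<p(n)<1$. For an algorithm $A$, let $\mu_A(n,n,p(n))$ be its matching size on $G(n,n,p(n))$ and $\mu_*(n,n,p(n))$ the maximum matching size of $G(n,n,p(n))$; the performance ratio is $\mathcal{R}_A(p(n)) := \lim_{n\to\infty} \frac{\mathbb{E}[\mu_A(n,n,p(n))]}{\mathbb{E}[\mu_*(n,n,p(n))]}$ (a lower bound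 $\mathcal{R}_A\ge x$ is to be read as $\liminf_{n\to\infty}$ of this ratio being $\ge x$). For $c>0$, $\gamma_*=\gamma_*(c)$ is the smallest root of $x=c\exp(-ce^{-x})$ and $\gamma^*=\gamma^*(c)=ce^{-\gamma_*}$; $\log$ is the natural logarithm. *)

(* Defs.v *)
From mathcomp Require Import all_boot all_order all_algebra.
From mathcomp Require Import all_classical all_reals all_analysis.

Set Implicit Arguments.
Unset Strict Implicit.
Unset Printing Implicit Defensive.

Import Order.TTheory GRing.Theory Num.Theory.
Import numFieldNormedType.Exports.

Local Open Scope ring_scope.

(* A bipartite graph with n bins and n balls is its set of edges (i, j),
   with i the bin and j the ball; balls arrive in the order 0, 1, ..., n-1. *)
Definition bigraph (n : nat) : finType := {set 'I_n * 'I_n}.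

Definition is_matching (n : nat) (M : {set 'I_n * 'I_n}) : bool :=
  [forall e in M, forall f in M,
     ((e.1 == f.1) || (e.2 == f.2)) ==> (e == f)].

Definition max_matching_size (n : nat) (g : bigraph n) : nat :=
  \max_(M : {set 'I_n * 'I_n} | (M \subset g) && is_matching M) #|M|.

(* An outcome of an online algorithm sends each ball to the bin it is matched
   with, or to None if the ball is dropped. *)
Definition outcome (n : nat) : finType := {ffun 'I_n -> option 'I_n}.

Definition outcome_size (n : nat) (m : outcome n) : nat :=
  #|[set j | m j != None]|.

(* U(j): only the decisions made for the balls preceding j are consulted. *)
Definition unmatched_nbrs (n : nat) (g : bigraph n) (m : outcome n) (j : 'I_n)
    : {set 'I_n} :=
  [set i | ((i, j) \in g) &&
           [forall j' : 'I_n, (j' < j)%N ==> (m j' != Some i)]].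

Section GreedyOnRandomGraph.
Variable R : realType.

(* Law of G(n,n,p): the edges are independent, each of probability p. *)
Definition gnnp_prob (n : nat) (p : R) (g : bigraph n) : R :=
  \prod_(e : 'I_n * 'I_n) (if e \in g then p else 1 - p).

(* Probability that greedy decides d for ball j, given the graph and the
   decisions made before j. *)
Definition greedy_step_prob (n : nat) (g : bigraph n) (m : outcome n)
    (j : 'I_n) (d : option 'I_n) : R :=
  let U := unmatched_nbrs g m j in
  match d with
  | None => (U == finset.set0)%:R
  | Some i => if i \in U then (#|U|%:R)^-1 else 0
  end.

(* Law of the outcome of greedy on the fixed graph g (chain rule). *)
Definition greedy_prob (n : nat) (g : bigraph n) (m : outcome n) : R :=
  \prod_(j < n) greedy_step_prob g m j (m j).

Definition E_greedy (n : nat) (p : R) : R :=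
  \sum_(g : bigraph n) \sum_(m : outcome n)
    gnnp_prob p g * greedy_prob g m * (outcome_size m)%:R.

Definition E_max_matching (n : nat) (p : R) : R :=
  \sum_(g : bigraph n) gnnp_prob p g * (max_matching_size g)%:R.

Definition greedy_ratio (p : nat -> R) (n : nat) : R :=
  E_greedy n (p n) / E_max_matching n (p n).

Definition valid (p : nat -> R) : Prop :=
  (forall n, (0 < n)%N -> 0 < p n < 1) /\
  ((forall m n, (0 < m)%N -> (m <= n)%N -> p m <= p n) \/
   (forall m n, (0 < m)%N -> (m <= n)%N -> p n <= p m)).

Definition gamma_root (c x : R) : Prop := x = c * expR (- c * expR (- x)).

Definition smallest_gamma_root (c x : R) : Prop :=
  gamma_root c x /\ forall y, gamma_root c y -> x <= y.

(* gamma_low is the lower-star gamma, gamma_upp the upper-star one; the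
   default value 0 of gamma_low is irrelevant for c > 0, by gamma_lowP. *)
Definition gamma_low (c : R) : R := xget 0 (smallest_gamma_root c).

Definition gamma_upp (c : R) : R := c * expR (- gamma_low c).

Lemma gnnp_prob_sum1 (n : nat) (p : R) :
  \sum_(g : bigraph n) gnnp_prob p g = 1.
Proof.
rewrite /gnnp_prob -(bigA_distr _ _ (fun=> p) (fun=> 1 - p)).
by rewrite big1// => e _; rewrite /= addrC subrK.
Qed.

Lemma gamma_lowP (c : R) : 0 < c -> smallest_gamma_root c (gamma_low c).
Proof.
move=> c0; rewrite /gamma_low; case: xgetP => [x _ //|none].
exfalso.
pose F x := c * expR (- c * expR (- x)).
have Fmono x y : x <= y -> F x <= F y.
  by move=> xy; rewrite ler_pM2l// ler_expR !mulNr lerN2 ler_pM2l// ler_expR lerN2.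
pose P : set R := [set x | F x <= x]%classic.
have P0 : lbound P 0.
  by move=> x; apply: le_trans; rewrite /F mulr_ge0 ?expR_ge0 ?ltW.
have Pn : (P !=set0)%classic.
  exists c; rewrite /P/= /F ger_pMr// -[leRHS]expR0 ler_expR mulNr oppr_le0.
  by rewrite mulr_ge0 ?expR_ge0 ?ltW.
have infP x : P x -> inf P <= x by move=> Px; apply: ge_inf => //; exists 0.
have Fs : F (inf P) <= inf P.
  by apply: lb_le_inf => // x Px; apply: (le_trans _ Px); apply/Fmono/infP.
apply: (none (inf P)); split.
  by apply/eqP; rewrite eq_le Fs andbT; apply/infP/Fmono.
by move=> y ry; apply: infP; rewrite /P/= /F -ry.
Qed.

End GreedyOnRandomGraph.

(* Main.v *)
(* Let q = 1 - p. If Y bins are free, the next ball leaves q^(-Y) - 1 multiplied by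
   q on average. Hence E[q^(-Y_n)] = 2 - q^n exactly for the final number Y_n of free
   bins, and Jensen's inequality gives
     E_greedy >= n - log(2 - q^n) / (- log q).
   With E_max <= n^2 p and E_max <= n this settles the cases p = o(1/n) and
   p = omega(1/n), and it gives the numerator for p = c/n.

   For the denominator, a bounded number of rounds of Karp-Sipser leaf removal yields
   a vertex cover whose membership events are local. Deleting a vertex v before
   exploring from its neighbours makes the edges at v independent of what is explored,
   so v has no losing neighbour with probability E[q^L], L being the number of losing
   vertices of the graph without v. A second moment argument shows that L/n
   concentrates around s_t, where s_0 = 1 and s_(t+1) = exp(- c s_t). The even and odd
   subsequences of c s_t converge to the upper and lower gamma, and the expected size
   of the cover tends to n (2c - (gamma^* + gamma_* + gamma^* gamma_* )) / c. *)
Require Import Defs.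
From mathcomp Require Import all_boot all_order all_algebra.
From mathcomp Require Import all_classical all_reals all_analysis.
From mathcomp Require Import ring lra.
From mathcomp.boot Require Import fintype finset.
Import Order.TTheory GRing.Theory Num.Theory.
Import numFieldNormedType.Exports.

Set Implicit Arguments.
Unset Strict Implicit.
Unset Printing Implicit Defensive.

Local Open Scope ring_scope.

(** * Expectation over the random bipartite graph and independence of its edges *)

Section Expectation.
Variables (R : realType) (n : nat) (p : R).
Implicit Types (F : bigraph n -> R) (g : bigraph n) (e : 'I_n * 'I_n).

Definition Eg F : R := \sum_(g : bigraph n) gnnp_prob p g * F g.

Lemma eq_Eg F F' : F =1 F' -> Eg F = Eg F'.
Proof. by move=> FF'; apply: eq_bigr => g _; rewrite FF'. Qed.

Lemma EgD F F' : Eg (fun g => F g + F' g) = Eg F + Eg F'.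
Proof. by rewrite -big_split; apply: eq_bigr => g _; rewrite mulrDr. Qed.

Lemma EgZ a F : Eg (fun g => a * F g) = a * Eg F.
Proof. by rewrite /Eg big_distrr; apply: eq_bigr => g _; rewrite mulrCA. Qed.

Lemma EgB F F' : Eg (fun g => F g - F' g) = Eg F - Eg F'.
Proof.
rewrite -[X in _ = _ + X]mulN1r -EgZ -EgD.
by apply: eq_Eg => g; rewrite mulN1r.
Qed.

Lemma Eg_sum (I : finType) (P : pred I) (F : I -> bigraph n -> R) :
  Eg (fun g => \sum_(i | P i) F i g) = \sum_(i | P i) Eg (F i).
Proof.
by rewrite /Eg exchange_big; apply: eq_bigr => g _; rewrite big_distrr.
Qed.

Lemma Eg_cst a : Eg (fun=> a) = a.
Proof. by rewrite /Eg -big_distrl/= gnnp_prob_sum1 mul1r. Qed.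

(** The hypothesis says that [F] does not read the edge [e]. Pairing each graph without [e] with the
    same graph plus [e] isolates the coin of [e] as a factor. *)
Lemma Eg_notin e F : (forall g, F (g :\ e) = F g) ->
  Eg (fun g => F g * (e \notin g)%:R) = (1 - p) * Eg F.
Proof.
move=> Fe.
pose w g : R := \prod_(f | f != e) (if f \in g then p else 1 - p).
have wE g : gnnp_prob p g = (if e \in g then p else 1 - p) * w g.
  by rewrite /gnnp_prob (bigD1 e).
have wU g : w (e |: g) = w g.
  by apply: eq_bigr => f fe; rewrite in_setU1 (negbTE fe).
have splitE G : Eg G = \sum_(g : bigraph n | e \notin g)
    w g * (p * G (e |: g) + (1 - p) * G g).
  rewrite /Eg (bigID (fun g : bigraph n => e \notin g))/=.
  rewrite (eq_bigl (fun g : bigraph n => e \in g) _ (fun=> negbK _)).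
  rewrite [X in _ + X](reindex_onto (fun g : bigraph n => e |: g : bigraph n)
     (fun g : bigraph n => g :\ e : bigraph n)); last by move=> g eg; exact: setD1K.
  rewrite [X in _ + X](eq_bigl (fun g : bigraph n => e \notin g)); last first.
    move=> g; rewrite setU11/=; apply/eqP/idP => [<-|eg].
      by rewrite !inE eqxx.
    by apply/setP => f; rewrite !inE; case: eqVneq => // ->; rewrite (negbTE eg).
  rewrite -big_split; apply: eq_bigr => g eg.
  by rewrite !wE setU11 (negbTE eg) wU /=; ring.
have FU g : e \notin g -> F (e |: g) = F g.
  by move=> eg; rewrite -(Fe (e |: g)) setU1K.
rewrite !splitE big_distrr; apply: eq_bigr => g eg /=.
by rewrite setU11 eg FU//=; ring.
Qed.

Lemma Eg_disjoint (D : bigraph n) F :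
  (forall g e, e \in D -> F (g :\ e) = F g) ->
  Eg (fun g => F g * [disjoint D & g]%:R) = (1 - p) ^+ #|D| * Eg F.
Proof.
move: {2}#|D| (erefl #|D|) => k; elim: k D F => [|k IH] D F Dk FD.
  have -> : D = set0 by apply/eqP; rewrite -cards_eq0 Dk.
  by rewrite cards0 mul1r; apply: eq_Eg => g; rewrite eq_disjoint0 ?mulr1// => x; rewrite inE.
have [e eD] : exists e, e \in D by apply/set0Pn; rewrite -cards_eq0 Dk.
have DE : #|D :\ e| = k by move: Dk; rewrite (cardsD1 e) eD => -[].
rewrite Dk exprSr -mulrA -(Eg_notin (e := e)); last by move=> g; exact: FD.
(* The absence of [e] is absorbed into the function, which still does not read the other edges of
   [D]. *)
transitivity (Eg (fun g => (F g * (e \notin g)%:R) * [disjoint D :\ e & g]%:R)).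
  apply: eq_Eg => g; rewrite -mulrA -natrM mulnb; congr (_ * _%:R).
  by rewrite !disjoints_subset -{1}(setD1K eD) subUset sub1set in_setC.
rewrite IH ?DE// => g f; rewrite !inE => /andP[fe fD].
by rewrite FD// (eq_sym e) fe.
Qed.

(* Conditionally on the edges outside [Q], the set [D g] is frozen and its edges
   are still independent. *)
Lemma Eg_disjoint_random (Q : bigraph n) (D : bigraph n -> bigraph n) F :
  (forall g, D g \subset Q) ->
  (forall g e, e \in Q -> F (g :\ e) = F g) ->
  (forall g e, e \in Q -> D (g :\ e) = D g) ->
  Eg (fun g => F g * [disjoint D g & g]%:R) =
  Eg (fun g => F g * (1 - p) ^+ #|D g|).
Proof.
move=> DQ FQ DgQ.
have part (G : bigraph n -> bigraph n -> R) : Eg (fun g => F g * G g (D g)) =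
    \sum_(X : bigraph n) Eg (fun g => (F g * (D g == X)%:R) * G g X).
  rewrite -Eg_sum; apply: eq_Eg => g.
  rewrite (bigD1 (D g))//= eqxx mulr1 big1 ?addr0// => X XD.
  by rewrite eq_sym (negbTE XD) mulr0 mul0r.
rewrite (part (fun g X => [disjoint X & g]%:R)) (part (fun _ X => (1 - p) ^+ #|X|)).
apply: eq_bigr => X _.
have [XQ|XQ] := boolP (X \subset Q); last first.
  by rewrite /Eg !big1// => g _; rewrite (_ : D g == X = false) ?mulr0 ?mul0r ?mulr0//;
    apply: contraNF XQ => /eqP <-.
rewrite Eg_disjoint.
  by rewrite -EgZ; apply: eq_Eg => g; rewrite mulrC.
by move=> g e /(subsetP XQ) eQ; rewrite FQ// DgQ.
Qed.

Hypothesis p01 : 0 <= p <= 1.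

Lemma gnnp_prob_ge0 g : 0 <= gnnp_prob p g.
Proof.
apply: prodr_ge0 => e _; case/andP: p01 => p0 p1.
by case: ifP => // _; rewrite subr_ge0.
Qed.

Lemma Eg_le F F' : (forall g, F g <= F' g) -> Eg F <= Eg F'.
Proof. by move=> FF'; apply: ler_sum => g _; rewrite ler_wpM2l ?gnnp_prob_ge0. Qed.

Lemma Eg_norm F : `|Eg F| <= Eg (fun g => `|F g|).
Proof.
apply: (le_trans (ler_norm_sum _ _ _)); apply: ler_sum => g _.
by rewrite normrM ger0_norm ?gnnp_prob_ge0.
Qed.

End Expectation.

(** * Symmetry between bins and balls *)

Definition transpose_graph n (g : bigraph n) : bigraph n :=
  [set e | (e.2, e.1) \in g].

Lemma in_transpose n (g : bigraph n) i j :
  ((i, j) \in transpose_graph g) = ((j, i) \in g).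
Proof. by rewrite inE. Qed.

Lemma transpose_graphK n : involutive (@transpose_graph n).
Proof. by move=> g; apply/setP => -[i j]; rewrite !in_transpose. Qed.

Lemma Eg_transpose (R : realType) n (p : R) (F : bigraph n -> R) :
  Eg p (fun g => F (transpose_graph g)) = Eg p F.
Proof.
rewrite /Eg [RHS](reindex_inj (inv_inj (@transpose_graphK n))).
apply: eq_bigr => g _; congr (_ * _); rewrite /gnnp_prob.
rewrite (reindex_onto (fun e : 'I_n * 'I_n => (e.2, e.1)) (fun e => (e.2, e.1))); last first.
  by case.
by apply: eq_big => [[i j]|[i j] _]; rewrite ?eqxx// in_transpose.
Qed.

(** * Greedy on a fixed graph, one arrival at a time *)

Section GreedyChain.
Variables (R : realType) (n : nat).
Implicit Types (g : bigraph n) (m : outcome n) (k : nat) (j : 'I_n).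

Definition occupied m : {set 'I_n} := [set i | [exists j, m j == Some i]].

(** A state after [k] arrivals is encoded as a full outcome with [None] from ball [k] on, so that
    all states live in one finite type. *)
Definition decided_before k m : bool :=
  [forall j : 'I_n, (k <= j)%N ==> (m j == None)].

Definition prefix_prob k g m : R :=
  \prod_(j < n | (j < k)%N) greedy_step_prob R g m j (m j).

Definition decide m j (d : option 'I_n) : outcome n :=
  [ffun j' => if j' == j then d else m j'].

Lemma eq_unmatched_nbrs g m m' j :
  (forall j', (j' < j)%N -> m j' = m' j') ->
  unmatched_nbrs g m j = unmatched_nbrs g m' j.
Proof.
move=> mm'; apply/setP => i; rewrite !inE; congr (_ && _).
apply/forallP/forallP => H j'; apply/implyP => jj'.
  by rewrite -mm'//; exact: (implyP (H j')).
by rewrite mm'//; exact: (implyP (H j')).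
Qed.

Lemma eq_greedy_step_prob g m m' j d :
  (forall j', (j' < j)%N -> m j' = m' j') ->
  greedy_step_prob R g m j d = greedy_step_prob R g m' j d.
Proof. by move=> mm'; rewrite /greedy_step_prob (eq_unmatched_nbrs _ mm'). Qed.

Lemma prefix_prob_decide g m j d :
  prefix_prob j.+1 g (decide m j d) =
  prefix_prob j g m * greedy_step_prob R g m j d.
Proof.
have dec j' : (j' < j)%N -> decide m j d j' = m j'.
  by move=> jj; rewrite ffunE; case: eqVneq => // E; rewrite E ltnn in jj.
rewrite /prefix_prob (bigD1 j)//= mulrC; congr (_ * _); last first.
  by rewrite ffunE eqxx; exact: eq_greedy_step_prob.
apply: eq_big => [j'|j' /andP[jj' ne]].
  by rewrite ltnS ltn_neqAle andbC.
have lt : (j' < j)%N by rewrite ltn_neqAle -ltnS jj' andbT.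
rewrite dec//; apply: eq_greedy_step_prob => j'' lt'.
by rewrite dec// (ltn_trans lt').
Qed.

(** One step of the chain: a state after ball [j] is, uniquely, a state before it together with a
    decision for [j]; resetting ball [j] to [None] recovers the former. *)
Lemma prefix_sumS g j (F : outcome n -> R) :
  \sum_(m | decided_before j.+1 m) prefix_prob j.+1 g m * F m =
  \sum_(m | decided_before j m)
    prefix_prob j g m * \sum_d greedy_step_prob R g m j d * F (decide m j d).
Proof.
under [RHS]eq_bigr do rewrite big_distrr.
rewrite pair_big_dep/=.
rewrite (reindex_onto (fun md : outcome n * option 'I_n => decide md.1 j md.2)
   (fun m => (decide m j None, m j))) /=; last first.
  by move=> m _; apply/ffunP => j'; rewrite !ffunE; case: eqVneq => // ->.
apply: eq_big => [[m d]|[m d] _] /=; last by rewrite prefix_prob_decide mulrA.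
rewrite andbT; apply/andP/forallP => [[/forallP mj /eqP[+ _]] j'|mj].
  move=> /ffunP/(_ j'); rewrite !ffunE => mj'; apply/implyP => jj'.
  case: eqVneq mj' => [_ <-//|ne _].
  have := mj j'; rewrite !ffunE (negbTE ne) => /implyP; apply.
  by rewrite ltn_neqAle jj' andbT eq_sym; exact: contra ne.
split.
  apply/forallP => j'; apply/implyP => jj'; rewrite ffunE.
  case: (eqVneq j' j) => [E|_]; first by rewrite E ltnn in jj'.
  exact: (implyP (mj j') (ltnW jj')).
apply/eqP; congr (_, _); last by rewrite ffunE eqxx.
apply/ffunP => j'; rewrite !ffunE; case: eqVneq => // ->.
by rewrite (eqP (implyP (mj j) (leqnn j))).
Qed.

Lemma prefix_sum0 g (F : outcome n -> R) :
  \sum_(m | decided_before 0 m) prefix_prob 0 g m * F m = F [ffun=> None].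
Proof.
rewrite (big_pred1 [ffun=> None]) => [|m].
  by rewrite /prefix_prob big_pred0 ?mul1r// => j; rewrite ltn0.
apply/forallP/eqP => [mN|-> j]; last by rewrite ffunE eqxx implybT.
by apply/ffunP => j; rewrite ffunE; exact/eqP/(implyP (mN j)).
Qed.

Lemma prefix_sum_all g (F : outcome n -> R) :
  \sum_(m | decided_before n m) prefix_prob n g m * F m =
  \sum_m greedy_prob R g m * F m.
Proof.
apply: eq_big => [m|m _].
  by apply/forallP => j; rewrite leqNgt ltn_ord.
by congr (_ * _); apply: eq_bigl => j; rewrite ltn_ord.
Qed.

(** When [F] takes one value on all free neighbours, the uniform choice averages out and only the
    emptiness of U(j) matters. *)
Lemma greedy_step_sum g m j (a b : R) (F : option 'I_n -> R) :
  F None = a -> (forall i, i \in unmatched_nbrs g m j -> F (Some i) = b) ->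
  \sum_d greedy_step_prob R g m j d * F d =
  if unmatched_nbrs g m j == set0 then a else b.
Proof.
move=> Fa Fb; rewrite (bigD1 None)//= Fa.
rewrite (reindex_omap Some id)/=; last by case.
rewrite (eq_bigl predT) => [|i]; last by rewrite eqxx.
rewrite (bigID (mem (unmatched_nbrs g m j)))/= [X in _ + (_ + X)]big1; last first.
  by move=> i /negbTE ->; rewrite mul0r.
rewrite addr0 (eq_bigr (fun=> #|unmatched_nbrs g m j|%:R^-1 * b)); last first.
  by move=> i iU; rewrite iU Fb.
rewrite sumr_const -[X in _ + X]mulr_natr; case: eqVneq => [->|U0].
  by rewrite mul1r cards0 mulr0n mulr0 addr0.
rewrite mul0r add0r mulrAC mulVf ?mul1r//.
by rewrite pnatr_eq0 cards_eq0.
Qed.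

Lemma greedy_prob_sum1 g : \sum_m greedy_prob R g m = 1.
Proof.
transitivity (\sum_(m | decided_before n m) prefix_prob n g m * 1).
  by rewrite prefix_sum_all; apply: eq_bigr => m _; rewrite mulr1.
suff H k : (k <= n)%N -> \sum_(m | decided_before k m) prefix_prob k g m * 1 = 1.
  exact: H.
elim: k => [_|k IH kn]; first by rewrite prefix_sum0.
rewrite (prefix_sumS g (Ordinal kn) (fun=> 1)) -[RHS]IH ?(ltnW kn)//.
apply: eq_bigr => m _; congr (_ * _).
by rewrite (@greedy_step_sum _ _ _ 1 1)// if_same.
Qed.

Lemma greedy_prob_ge0 g m : 0 <= greedy_prob R g m.
Proof.
apply: prodr_ge0 => j _; rewrite /greedy_step_prob; case: (m j) => [i|].
  by case: ifP => // _; rewrite invr_ge0 ler0n.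
by rewrite ler0n.
Qed.

Lemma unmatched_nbrs_prefix g m j : decided_before j m ->
  unmatched_nbrs g m j = [set i | ((i, j) \in g) && (i \notin occupied m)].
Proof.
move=> /forallP mj; apply/setP => i; rewrite !inE; congr (_ && _).
rewrite negb_exists; apply: eq_forallb => j'.
case: ltnP => //= jj'; apply/esym.
by rewrite (eqP (implyP (mj j') jj')).
Qed.

Lemma occupied_decide m j i : m j = None -> i \notin occupied m ->
  #|occupied (decide m j (Some i))| = #|occupied m|.+1.
Proof.
move=> mj iO; rewrite (_ : occupied _ = i |: occupied m) ?cardsU1 ?iO//.
apply/setP => i'; rewrite !inE; apply/existsP/orP => [[j']|].
  rewrite ffunE; case: (eqVneq j' j) => [_ /eqP[->]|_ mj']; first by left.
  by right; apply/existsP; exists j'.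
move=> [/eqP ->|/existsP[j' mj']]; first by exists j; rewrite ffunE eqxx.
exists j'; rewrite ffunE; case: (eqVneq j' j) => // E; move: mj'.
by rewrite E mj.
Qed.

Lemma occupied_decide_None m j : m j = None -> occupied (decide m j None) = occupied m.
Proof.
move=> mj; congr occupied; apply/ffunP => j'; rewrite ffunE.
by case: eqVneq => // ->.
Qed.

(** An arbitrary outcome may send several balls to one bin, hence an inequality; it has the
    direction that a lower bound on greedy needs. *)
Lemma card_occupied_le m : (#|occupied m| <= outcome_size m)%N.
Proof.
apply: (leq_trans _ (leq_imset_card (fun j => odflt j (m j)) _)).
apply/subset_leq_card/subsetP => i; rewrite inE => /existsP[j /eqP mj].
by apply/imsetP; exists j; rewrite ?inE mj.
Qed.

(** An outcome of nonzero probability takes only legal decisions, so these form a matching of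
    [g]. *)
Lemma greedy_size_le_max g m : greedy_prob R g m != 0 ->
  (outcome_size m <= max_matching_size g)%N.
Proof.
move=> gm0.
have step j : greedy_step_prob R g m j (m j) != 0.
  by apply: contra gm0 => /eqP s0; rewrite /greedy_prob (bigD1 j)//= s0 mul0r.
have inU j i : m j = Some i -> i \in unmatched_nbrs g m j.
  by move=> mj; have := step j; rewrite mj /=; case: ifP => //; rewrite eqxx.
pose M : {set 'I_n * 'I_n} := [set e | m e.2 == Some e.1].
have sz : outcome_size m = #|M|.
  rewrite -(@card_in_imset _ _ (fun e : 'I_n * 'I_n => e.2) M).
    congr #|pred_of_set _|; apply/setP => j; rewrite inE.
    apply/idP/imsetP => [|[[i j'] + ->]]; last by rewrite inE/= => /eqP ->.
    by case mj: (m j) => [i|]// _; exists (i, j) => //; rewrite inE/= mj.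
  move=> [i j] [i' j']; rewrite !inE/= => /eqP mj /eqP mj' jj'.
  by move: mj'; rewrite -jj' mj => -[->].
rewrite sz /max_matching_size; apply: (@leq_bigmax_cond _
  (fun M : {set 'I_n * 'I_n} => (M \subset g) && is_matching M) (fun M => #|M|) M).
apply/andP; split.
  by apply/subsetP => -[i j]; rewrite inE/= => /eqP/inU; rewrite inE => /andP[].
(* The later of two balls sent to one bin would have found it taken. *)
have key i j j' : m j = Some i -> m j' = Some i -> ~~ (j' < j)%N.
  move=> /inU; rewrite inE => /andP[_ /forallP/(_ j')/implyP H] mj'.
  by apply/negP => /H; rewrite mj' eqxx.
apply/forallP => -[i j]; apply/implyP; rewrite inE/= => /eqP mj.
apply/forallP => -[i' j']; apply/implyP; rewrite inE/= => /eqP mj'.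
apply/implyP => /orP[/eqP ii'|/eqP jj'].
  apply/eqP; congr (_, _) => //; apply: val_inj; apply/eqP.
  rewrite -ii' in mj'.
  by rewrite /= eqn_leq leqNgt (key _ _ _ mj mj') leqNgt (key _ _ _ mj' mj).
by move: mj'; rewrite -jj' mj => -[->].
Qed.

End GreedyChain.

(** * The exponential potential and bounds on the expected sizes *)

Section GreedyExpectation.
Variables (R : realType) (n : nat) (p : R).
Hypothesis p01 : 0 < p < 1.
Let q : R := 1 - p.
Implicit Types (g : bigraph n) (m : outcome n) (k : nat) (j : 'I_n).

Let q0 : 0 < q. Proof. by rewrite subr_gt0; case/andP: p01. Qed.
Let q1 : q < 1. Proof. by rewrite /q; case/andP: p01 => ? _; lra. Qed.
Let p01W : 0 <= p <= 1. Proof. by case/andP: p01 => /ltW -> /ltW ->. Qed.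

Lemma eq_prefix_prob k g g' m :
  (forall i j, (j < k)%N -> ((i, j) \in g) = ((i, j) \in g')) ->
  prefix_prob R k g m = prefix_prob R k g' m.
Proof.
move=> gg'; apply: eq_bigr => j jk; rewrite /greedy_step_prob.
rewrite (_ : unmatched_nbrs g m j = unmatched_nbrs g' m j)//.
by apply/setP => i; rewrite !inE gg'.
Qed.

(** Deferred decisions: the state before ball [j] reads only edges of earlier balls, so the edges
    from [j] to the free bins are still fresh, and all of them are absent with probability [q] to
    the number of free bins. *)
Lemma greedy_chain_step j (f : nat -> R) :
  Eg p (fun g => \sum_(m | decided_before j.+1 m)
    prefix_prob R j.+1 g m * f #|occupied m|) =
  Eg p (fun g => \sum_(m | decided_before j m) prefix_prob R j g m *
    (q ^+ (n - #|occupied m|) * f #|occupied m| +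
     (1 - q ^+ (n - #|occupied m|)) * f #|occupied m|.+1)).
Proof.
pose D m : bigraph n := setX (~: occupied m) [set j].
transitivity (Eg p (fun g => \sum_(m | decided_before j m)
   (prefix_prob R j g m * f #|occupied m|.+1 +
    (f #|occupied m| - f #|occupied m|.+1) *
      (prefix_prob R j g m * [disjoint D m & g]%:R)))).
  apply: eq_Eg => g; rewrite prefix_sumS; apply: eq_bigr => m mj.
  have mjN : m j = None by apply/eqP/(implyP (forallP mj j)).
  rewrite (@greedy_step_sum _ _ _ _ _ (f #|occupied m|) (f #|occupied m|.+1)).
  - rewrite unmatched_nbrs_prefix//.
    rewrite (_ : (_ == set0) = [disjoint D m & g]); last first.
      rewrite -setI_eq0; apply/eqP/eqP => /setP E0; apply/setP.
        move=> [i j']; have := E0 i; rewrite !inE/=.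
        by case: eqVneq => [->|_]; rewrite ?andbF ?andbT ?andFb// andbC.
      by move=> i; have := E0 (i, j); rewrite !inE eqxx andbT/= andbC.
    by case: ifP => _; rewrite /=; ring.
  - by rewrite occupied_decide_None.
  - move=> i; rewrite unmatched_nbrs_prefix// inE => /andP[_ iO].
    by rewrite occupied_decide.
rewrite !Eg_sum; apply: eq_bigr => m _.
have cD : #|D m| = (n - #|occupied m|)%N.
  by rewrite cardsX cards1 muln1 cardsCs setCK card_ord.
rewrite EgD EgZ Eg_disjoint.
  rewrite -/q cD -!EgZ -EgD.
  by apply: eq_Eg => g; ring.
move=> g [i j']; rewrite !inE/= => /andP[_ /eqP ->].
apply: eq_prefix_prob => i' j'' lt; rewrite !inE/=.
case: eqVneq => // -[_ E]; by rewrite E ltnn in lt.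
Qed.

Lemma greedy_chain_potential k : (k <= n)%N ->
  Eg p (fun g => \sum_(m | decided_before k m)
    prefix_prob R k g m * ((q ^+ (n - #|occupied m|))^-1 - 1)) =
  q ^+ k * ((q ^+ n)^-1 - 1).
Proof.
pose f o : R := (q ^+ (n - o))^-1 - 1.
elim: k => [_|k IH kn].
  rewrite expr0 mul1r -[RHS](Eg_cst n p); apply: eq_Eg => g.
  rewrite (prefix_sum0 g (fun m => f #|occupied m|)) /f.
  rewrite (_ : occupied _ = set0) ?cards0 ?subn0//.
  by apply/setP => i; rewrite !inE; apply/existsP => -[j]; rewrite ffunE.
rewrite (greedy_chain_step (Ordinal kn) f) exprS -mulrA -IH ?(ltnW kn)// -EgZ.
apply: eq_Eg => g; rewrite big_distrr; apply: eq_bigr => m _ /=.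
rewrite mulrCA; congr (_ * _); rewrite /f.
have : (#|occupied m| <= n)%N by rewrite -[X in (_ <= X)%N]card_ord max_card.
(* With no free bin left, the potential is zero and a further match has weight zero. *)
rewrite leq_eqVlt => /orP[/eqP ->|lt].
  by rewrite subnn expr0 subrr mul0r addr0 invr1 subrr !mulr0.
rewrite -(subnSK lt) exprS; set z := q ^+ _.
have z0 : z != 0 by rewrite expf_neq0// gt_eqF.
by field; rewrite z0 gt_eqF.
Qed.

Definition Egreedy (F : outcome n -> R) : R :=
  Eg p (fun g => \sum_m greedy_prob R g m * F m).

Lemma Egreedy_size : E_greedy n p = Egreedy (fun m => (outcome_size m)%:R).
Proof.
apply: eq_bigr => g _; rewrite big_distrr; apply: eq_bigr => m _.
by rewrite /= mulrA.
Qed.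

Lemma Egreedy_le F F' : (forall m, F m <= F' m) -> Egreedy F <= Egreedy F'.
Proof.
move=> FF'; apply: Eg_le => // g; apply: ler_sum => m _.
by rewrite ler_wpM2l ?greedy_prob_ge0.
Qed.

Lemma Egreedy_affine a b F : Egreedy (fun m => a + b * F m) = a + b * Egreedy F.
Proof.
rewrite /Egreedy -EgZ -[X in _ = X + _](Eg_cst n p) -EgD; apply: eq_Eg => g.
rewrite -[X in _ = X + _]mul1r -(greedy_prob_sum1 R g) big_distrl big_distrr -big_split.
by apply: eq_bigr => m _ /=; ring.
Qed.

Lemma E_greedy_ge : n%:R - ln (2 - q ^+ n) / (- ln q) <= E_greedy n p.
Proof.
pose Y m : R := (n - #|occupied m|)%:R.
pose l := - ln q.
have l0 : 0 < l by rewrite oppr_gt0 ln_lt0// q0.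
have qE k : (q ^+ k)^-1 = expR (l * k%:R).
  by rewrite -[in LHS](lnK q0) -expRM_natr -expRN mulNr.
pose mu := Egreedy Y.
have szE : n%:R - mu <= E_greedy n p.
  rewrite Egreedy_size -mulN1r -Egreedy_affine; apply: Egreedy_le => m.
  have on : (#|occupied m| <= n)%N by rewrite -[X in (_ <= X)%N]card_ord max_card.
  by rewrite /Y natrB// mulN1r opprB addrC subrK ler_nat card_occupied_le.
apply: le_trans szE; rewrite lerD2l lerN2 -/l ler_pdivlMr//.
have qn1 : q ^+ n <= 1 by rewrite exprn_ile1// ltW.
rewrite -(@ler_expR R) lnK; last by rewrite posrE; lra.
have pot : Egreedy (fun m => -1 + 1 * expR (l * Y m)) = 1 - q ^+ n.
  have := greedy_chain_potential (leqnn n).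
  rewrite mulrBr mulr1 mulfV ?expf_neq0 ?gt_eqF// => <-.
  apply: eq_Eg => g; rewrite prefix_sum_all; apply: eq_bigr => m _.
  by rewrite mul1r -qE addrC.
have -> : 2 - q ^+ n = Egreedy (fun m => expR (l * Y m)).
  by move: pot; rewrite Egreedy_affine; lra.
(* Jensen by hand: the tangent of the exponential at [mu * l], evaluated at [l * Y m], is affine in
   [Y m] and has mean [expR (mu * l)]. *)
have -> : expR (mu * l) = Egreedy (fun m => (expR (mu * l) * (1 - l * mu)) +
    (expR (mu * l) * l) * Y m).
  by rewrite Egreedy_affine -/mu; ring.
apply: Egreedy_le => m; rewrite -mulrA -mulrDr.
have -> : l * Y m = mu * l + (l * Y m - mu * l) by ring.
rewrite expRD ler_pM2l ?expR_gt0//.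
by apply: le_trans (expR_ge1Dx _); lra.
Qed.

Lemma E_greedy_le_max : E_greedy n p <= E_max_matching n p.
Proof.
rewrite Egreedy_size; apply: Eg_le => // g.
rewrite -[leRHS]mul1r -[X in _ <= X * _](greedy_prob_sum1 R g) big_distrl/=.
apply: ler_sum => m _.
have [->|gm0] := eqVneq (greedy_prob R g m) 0; first by rewrite !mul0r.
by rewrite ler_wpM2l ?greedy_prob_ge0// ler_nat (greedy_size_le_max gm0).
Qed.

Lemma max_matching_le_card g : (max_matching_size g <= #|g|)%N.
Proof. by apply/bigmax_leqP => M /andP[/subset_leq_card]. Qed.

Lemma max_matching_le_n g : (max_matching_size g <= n)%N.
Proof.
apply/bigmax_leqP => M /andP[_ /forallP MM].
rewrite -[X in (_ <= X)%N](card_ord n).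
rewrite -(@card_in_imset _ _ (fun e : 'I_n * 'I_n => e.1) M) ?max_card//.
move=> e f eM fM ef; have := implyP (MM e) eM.
by move=> /forallP/(_ f)/implyP/(_ fM); rewrite ef eqxx => /eqP.
Qed.

Lemma E_max_le_n : E_max_matching n p <= n%:R.
Proof.
rewrite -[leRHS](Eg_cst n p); apply: Eg_le => // g.
by rewrite ler_nat max_matching_le_n.
Qed.

Lemma E_max_le_edges : E_max_matching n p <= n%:R * n%:R * p.
Proof.
have -> : n%:R * n%:R * p = Eg p (fun g : bigraph n => #|g|%:R).
  transitivity (Eg p (fun g : bigraph n =>
      \sum_(e : 'I_n * 'I_n) (1 - (1 * (e \notin g)%:R)))).
    rewrite Eg_sum (eq_bigr (fun=> p)) => [|e _].
      by rewrite sumr_const card_prod card_ord -natrM mulr_natl.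
    by rewrite EgB (@Eg_notin _ _ _ e (fun=> 1))// Eg_cst; ring.
  apply: eq_Eg => g; rewrite -sum1_card natr_sum [RHS]big_mkcond; apply: eq_bigr => e _.
  by rewrite mul1r; case: (e \in g); rewrite /= ?subr0 ?subrr.
by apply: Eg_le => // g; rewrite ler_nat max_matching_le_card.
Qed.

End GreedyExpectation.

(** * Leaf removal and the vertex cover it yields *)

Section Cover.
Variable n : nat.
Implicit Types (g : bigraph n) (A B : {set 'I_n}) (u v x y : 'I_n) (t k : nat).

(* Karp-Sipser leaf removal, [t] rounds deep, in the graph deprived of the bins
   [A] and the balls [B]: [v] wins if some neighbour loses once [v] is deleted.
   [v] is always on the first side of [g], hence the transpositions. *)
Fixpoint winner t A B g v : bool :=
  if t is t'.+1 then
    [exists u, [&& u \notin B, (v, u) \in g &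
                   ~~ winner t' B (v |: A) (transpose_graph g) u]]
  else false.

Definition losers t A B g : {set 'I_n} :=
  [set u | (u \notin A) && ~~ winner t A B g u].

(** Expresses winning through a set of edges met by [g], the form that [Eg_disjoint_random]
    handles. *)
Lemma winnerS t A B g v : winner t.+1 A B g v =
  ~~ [disjoint setX [set v] (losers t B (v |: A) (transpose_graph g)) & g].
Proof.
rewrite -setI_eq0; apply/existsP/set0Pn => [[u /and3P[uB vu wu]]|[[v' u]]].
  by exists (v, u); rewrite !inE eqxx/= uB wu.
rewrite !inE/= => /andP[/and3P[/eqP -> uB wu] vu].
by exists u; rewrite uB vu wu.
Qed.

Lemma eq_winner t A B g g' v : v \notin A ->
  (forall a b, a \notin A -> b \notin B -> ((a, b) \in g) = ((a, b) \in g')) ->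
  winner t A B g v = winner t A B g' v.
Proof.
elim: t A B g g' v => //= t IH A B g g' v vA gg'.
apply: eq_existsb => u; case: (boolP (u \in B)) => //= uB.
rewrite gg'//; congr (_ && ~~ _); apply: IH => // b a bB.
by rewrite !inE => /norP[_ aA]; exact: gg'.
Qed.

(** Deleting vertices on the side of [v] removes rivals, and restoring vertices on the other side
    adds possible losers; the two roles swap with each round. *)
Lemma winner_mono t A A' B B' g v : A \subset A' -> B' \subset B ->
  winner t A B g v -> winner t A' B' g v.
Proof.
elim: t A A' B B' g v => //= t IH A A' B B' g v AA' BB'.
move=> /existsP[u /and3P[uB vu wu]]; apply/existsP; exists u.
rewrite vu (contra (subsetP BB' u) uB)/=; apply: contra wu; apply: IH => //.
by rewrite setUS.
Qed.

(** Nobody wins at depth 0, and each round reverses implications: winners grow along even depths and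
    shrink along odd ones. *)
Lemma winner_parity t A B g v :
  if odd t then winner t.+2 A B g v -> winner t A B g v
  else winner t A B g v -> winner t.+2 A B g v.
Proof.
elim: t A B g v => // t IH A B g v; rewrite oddS.
have step s s' : (forall A B g v, winner s A B g v -> winner s' A B g v) ->
    winner s'.+1 A B g v -> winner s.+1 A B g v.
  move=> ss' /existsP[u /and3P[uB vu wu]]; apply/existsP; exists u.
  by rewrite uB vu; apply: contra wu; exact: ss'.
case ot: (odd t) IH => IH /=.
  by apply: (step t.+2 t) => ? ? ? ?; exact: IH.
by apply: (step t t.+2) => ? ? ? ?; exact: IH.
Qed.

(* One losing neighbour [y] does not put the bin [x] in the cover: [x] then loses
   in the graph without [y], so that [y] is covered. *)
Definition cover_left k g : {set 'I_n} :=
  [set x | (1 < #|[set y in losers k.*2 set0 (x |: set0) (transpose_graph g)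
                  | (x, y) \in g]|)%N].

Definition cover_right k g : {set 'I_n} :=
  [set y | winner k.*2.+2 set0 set0 (transpose_graph g) y].

(** Suppose that neither end is in the cover. Then every neighbour of [y] wins once [y] is deleted;
    in particular [x] has a losing neighbour [y'] other than [y]. As [x] has at most one losing
    neighbour, [y] wins without [x], through some losing neighbour [x'], although [x'] should
    win. *)
Lemma cover_edge k g x y : (x, y) \in g ->
  (x \in cover_left k g) || (y \in cover_right k g).
Proof.
move=> xy; apply/norP; rewrite !inE -leqNgt => -[xC /existsPn yC].
have win x' : (x', y) \in g -> winner k.*2.+1 set0 (y |: set0) g x'.
  move=> x'y; have := yC x'.
  by rewrite transpose_graphK in_transpose x'y in_set0/= negbK.
have /existsP[y' /and3P[y'y xy' wy']] := win _ xy.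
set S := [set y in _ | _] in xC.
have y'S : y' \in S.
  rewrite !inE xy' andbT; apply: contra wy'; apply: winner_mono => //.
  exact: sub0set.
have yS : y \notin S.
  apply/negP => yS; move: y'y; rewrite !inE orbF => /negP; apply.
  by rewrite (card_le1_eqP xC _ _ y'S yS).
have wy : winner k.*2 set0 (x |: set0) (transpose_graph g) y.
  by move: yS; rewrite !inE xy andbT negbK.
(* At depth zero [wy] is absurd. Otherwise [x'] loses at an odd depth two below the one at which it
   wins, against the parity monotonicity. *)
clear S yC wy' xC y'S yS; case: k win wy => // k win.
move=> /existsP[x' /and3P[_ ]]; rewrite in_transpose transpose_graphK => x'y /negP; apply.
have := winner_parity k.*2.+1 (x |: set0) (y |: set0) g x'.
rewrite /= odd_double/=; apply; apply: winner_mono (win _ x'y) => //.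
exact: sub0set.
Qed.

(** Weak duality: distinct edges of a matching are charged to distinct vertices of the cover. *)
Lemma max_matching_le_cover k g :
  (max_matching_size g <= #|cover_left k g| + #|cover_right k g|)%N.
Proof.
apply/bigmax_leqP => M /andP[/subsetP Mg /forallP MM].
have inj e f : e \in M -> f \in M -> (e.1 == f.1) || (e.2 == f.2) -> e = f.
  by move=> eM fM /(implyP (implyP (forallP (implyP (MM e) eM) f) fM))/eqP.
pose L := [set e in M | e.1 \in cover_left k g].
rewrite -(cardsID L M); apply: leq_add.
  rewrite -(@card_in_imset _ _ (fun e : 'I_n * 'I_n => e.1)); last first.
    move=> e f; rewrite !inE => /andP[eM _] /andP[fM _] ef.
    by apply: inj => //; rewrite ef eqxx.
  apply/subset_leq_card/subsetP => x /imsetP[e + ->].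
  by rewrite in_setI [e \in L]inE => /and3P[].
rewrite -(@card_in_imset _ _ (fun e : 'I_n * 'I_n => e.2)); last first.
  move=> e f; rewrite !in_setD => /andP[_ eM] /andP[_ fM] ef.
  by apply: inj => //; rewrite ef eqxx orbT.
apply/subset_leq_card/subsetP => y /imsetP[[x y'] + ->] /=.
rewrite in_setD [_ \in L]inE => /andP[+ eM]; rewrite eM/= => xC.
by have := cover_edge k (Mg _ eM); rewrite (negbTE xC).
Qed.

End Cover.

(** * Elementary bounds on exponentials and powers *)

Section ExpBounds.
Variable R : realType.
Implicit Types a b x y : R.

Lemma expRN_lin x : 0 <= x -> `|1 - x - expR (- x)| <= x ^+ 2.
Proof.
move=> x0; have lo := expR_ge1Dx (- x).
have hi : expR (- x) <= (1 + x)^-1.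
  rewrite expRN lef_pV2 ?posrE ?expR_gt0 ?expR_ge1Dx//; lra.
have : (1 + x)^-1 <= 1 - x + x ^+ 2.
  rewrite -[leLHS]mul1r ler_pdivrMr; last lra.
  have -> : (1 - x + x ^+ 2) * (1 + x) = 1 + x ^+ 3 by ring.
  by rewrite lerDl exprn_ge0.
by rewrite ler_norml => h; apply/andP; split; lra.
Qed.

Lemma expRN_lip x y : 0 <= x -> 0 <= y ->
  `|expR (- x) - expR (- y)| <= `|x - y|.
Proof.
wlog xy : x y / x <= y => [H x0 y0|x0 y0].
  have [xy|/ltW yx] := leP x y; first exact: H.
  by rewrite distrC [leRHS]distrC H.
rewrite ger0_norm; last by rewrite subr_ge0 ler_expR lerN2.
rewrite distrC ger0_norm ?subr_ge0//.
have -> : expR (- y) = expR (- x) * expR (x - y) by rewrite -expRD; congr expR; ring.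
have e1 : expR (- x) <= 1 by rewrite -expR0 ler_expR oppr_le0.
have e2 := expR_ge1Dx (x - y).
rewrite -[X in X - _]mulr1 -mulrBr; apply: (@le_trans _ _ (1 * (y - x))); last by rewrite mul1r.
apply: ler_pM => //; rewrite ?expR_ge0//; last lra.
by rewrite subr_ge0 -expR0 ler_expR subr_le0.
Qed.

Lemma exprn_lip a b m : 0 <= a <= 1 -> 0 <= b <= 1 ->
  `|a ^+ m - b ^+ m| <= m%:R * `|a - b|.
Proof.
move=> /andP[a0 a1] /andP[b0 b1]; elim: m => [|m IH].
  by rewrite subrr normr0 mul0r.
have -> : a ^+ m.+1 - b ^+ m.+1 = a * (a ^+ m - b ^+ m) + (a - b) * b ^+ m.
  by rewrite !exprS; ring.
apply: (le_trans (ler_normD _ _)); rewrite !normrM (ger0_norm a0).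
rewrite (ger0_norm (exprn_ge0 _ b0)) -natr1 mulrDl mul1r; apply: lerD.
  apply: le_trans IH; rewrite -[leRHS]mul1r ler_wpM2r//.
by rewrite -[leRHS]mulr1 ler_wpM2l// exprn_ile1.
Qed.

End ExpBounds.

(** * Concentration of the proportion of losers *)

Section Concentration.
Variables (R : realType) (n : nat) (c : R).
Hypotheses (n0 : (0 < n)%N) (c0 : 0 < c) (cn : c < n%:R).
Let p : R := c / n%:R.
Let q : R := 1 - p.
Implicit Types (g : bigraph n) (A B : {set 'I_n}) (v x y : 'I_n) (t : nat).

Let nR : 0 < n%:R :> R. Proof. by rewrite ltr0n. Qed.
Let p0 : 0 < p. Proof. by rewrite divr_gt0. Qed.
Let p1 : p < 1. Proof. by rewrite ltr_pdivrMr// mul1r. Qed.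
Let p01 : 0 <= p <= 1. Proof. by rewrite !ltW. Qed.
Let q01 : 0 <= q <= 1. Proof. by rewrite /q; move: p0 p1 => ? ?; lra. Qed.

(** Replacing one factor [1 - p] by [expR (- p)] costs at most [p ^+ 2], and at most [n] factors are
    replaced. *)
Lemma qX_approx m : (m <= n)%N ->
  `|q ^+ m - expR (- (c * (m%:R / n%:R)))| <= c ^+ 2 / n%:R.
Proof.
move=> mn.
have -> : expR (- (c * (m%:R / n%:R))) = expR (- p) ^+ m.
  by rewrite -expRM_natr; congr expR; rewrite /p; ring.
have e01 : 0 <= expR (- p) <= 1.
  by rewrite expR_ge0 -expR0 ler_expR oppr_le0 ltW.
apply: (le_trans (exprn_lip _ q01 e01)).
apply: (@le_trans _ _ (n%:R * p ^+ 2)).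
  by apply: ler_pM => //; rewrite ?ler_nat// expRN_lin// ltW.
by rewrite /p le_eqVlt; apply/orP; left; apply/eqP; field; rewrite gt_eqF.
Qed.

(** An exploration deprived of [A] reads no edge at a vertex of [A]; this is what leaves the edges
    at a deleted vertex fresh. *)
Lemma losers_remove t B A g e : e.1 \in A ->
  losers t B A (transpose_graph (g :\ e)) = losers t B A (transpose_graph g).
Proof.
case: e => v w /= vA; apply/setP => u; rewrite !inE.
case: (boolP (u \in B)) => //= uB; congr (~~ _); apply: eq_winner => // b a _ aA.
rewrite !inE xpair_eqE/=; case: (eqVneq a v) => // E.
by rewrite E vA in aA.
Qed.

Lemma E_loser t A B v : v \notin A ->
  Eg p (fun g => (~~ winner t.+1 A B g v)%:R) =
  Eg p (fun g => q ^+ #|losers t B (v |: A) g|).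
Proof.
move=> vA; rewrite -[RHS]Eg_transpose.
pose D g : bigraph n := setX [set v] (losers t B (v |: A) (transpose_graph g)).
transitivity (Eg p (fun g => 1 * [disjoint D g & g]%:R)).
  by apply: eq_Eg => g; rewrite winnerS negbK mul1r.
rewrite (@Eg_disjoint_random _ _ _ (setX [set v] setT))//.
- by apply: eq_Eg => g; rewrite mul1r cardsX cards1 mul1n.
- by move=> g; apply/subsetP => -[a b]; rewrite !inE => /andP[->].
- move=> g [a b]; rewrite !inE/= andbT => /eqP ->.
  by rewrite /D losers_remove// !inE eqxx.
Qed.

(** Each of the two vertices is deleted from the exploration of the other, so both test the same set
    of losers through disjoint sets of fresh edges; hence the square. *)
Lemma E_loser2 t A B v v' : v != v' -> v \notin A -> v' \notin A ->
  Eg p (fun g => (~~ winner t.+1 (v' |: A) B g v)%:R *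
                 (~~ winner t.+1 (v |: A) B g v')%:R) =
  Eg p (fun g => (q ^+ #|losers t B (v |: (v' |: A)) g|) ^+ 2).
Proof.
move=> vv' vA v'A; rewrite -[RHS]Eg_transpose.
pose S g := losers t B (v |: (v' |: A)) (transpose_graph g).
pose D g : bigraph n := setX [set v; v'] (S g).
transitivity (Eg p (fun g => 1 * [disjoint D g & g]%:R)).
  apply: eq_Eg => g; rewrite !winnerS !negbK mul1r -natrM mulnb.
  rewrite (setUCA [set v']) -/(S g); congr ((nat_of_bool _)%:R).
  rewrite -!setI_eq0; apply/andP/eqP => [[/eqP/setP E1 /eqP/setP E2]|/setP E].
    apply/setP => -[a b]; have := E1 (a, b); have := E2 (a, b); rewrite !inE/=.
    by case: (a == v); case: (a == v').
  by split; apply/eqP/setP => -[a b]; have := E (a, b); rewrite !inE/=;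
    case: (a == v); case: (a == v') => //=.
rewrite (@Eg_disjoint_random _ _ _ (setX [set v; v'] setT))//.
- by apply: eq_Eg => g; rewrite mul1r cardsX cards2 vv' mulnC exprM.
- by move=> g; apply/subsetP => -[a b]; rewrite !inE => /andP[->].
- move=> g [a b]; rewrite !inE/= andbT => ab.
  by rewrite /D /S losers_remove// !inE orbA ab.
Qed.

(** The sequence s_t, which is also the probability that the root of a Poisson(c) branching tree
    loses at depth [t]. *)
Definition density_limit t : R := iter t (fun z => expR (- (c * z))) 1.

Lemma density_limit_ge0 t : 0 <= density_limit t.
Proof. by case: t => [|t] //=; exact: expR_ge0. Qed.

Lemma density_limit_le1 t : density_limit t <= 1.
Proof.
case: t => [|t] //=; rewrite -expR0 ler_expR oppr_le0.
by rewrite mulr_ge0 ?density_limit_ge0// ltW.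
Qed.

Definition deviation t A B : R :=
  Eg p (fun g => `|#|losers t A B g|%:R / n%:R - density_limit t|).

Lemma deviation_ge0 t A B : 0 <= deviation t A B.
Proof. by rewrite -(Eg_cst n p 0); apply: Eg_le. Qed.

Let card_le_n (S : {set 'I_n}) : (#|S| <= n)%N.
Proof. by rewrite -[X in (_ <= X)%N](card_ord n) max_card. Qed.

Lemma E_qX_approx t A B :
  Eg p (fun g => `|q ^+ #|losers t A B g| - density_limit t.+1|) <=
  c ^+ 2 / n%:R + c * deviation t A B.
Proof.
rewrite -EgZ -(Eg_cst n p (_ / _)) -EgD; apply: Eg_le => // g.
set m := #|_|; set d := density_limit t.
have -> : density_limit t.+1 = expR (- (c * d)) by [].
apply: (le_trans (ler_distD (expR (- (c * (m%:R / n%:R)))) _ _)).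
apply: lerD; first exact/qX_approx/card_le_n.
have mn0 : 0 <= c * (m%:R / n%:R) by rewrite mulr_ge0 ?divr_ge0 ?ler0n// ltW.
have d0 : 0 <= c * d by rewrite mulr_ge0 ?density_limit_ge0// ltW.
by apply: (le_trans (expRN_lip mn0 d0)); rewrite -mulrBr normrM gtr0_norm.
Qed.

Lemma E_loser_approx t A B v : v \notin A ->
  `|Eg p (fun g => (~~ winner t.+1 A B g v)%:R) - density_limit t.+1| <=
  c ^+ 2 / n%:R + c * deviation t B (v |: A).
Proof.
move=> vA; rewrite E_loser// -(Eg_cst n p (density_limit _)) -EgB.
by apply: le_trans (E_qX_approx _ _ _); exact: Eg_norm.
Qed.

(* Deleting [v'] from the graph seen by [v], and vice versa, makes the two events
   conditionally independent; by monotonicity its cost is a difference of means. *)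
Lemma E_loser_cov t A B v v' (d : R) : v != v' -> v \notin A -> v' \notin A ->
  deviation t B (v |: A) <= d -> deviation t B (v' |: A) <= d ->
  deviation t B (v |: (v' |: A)) <= d ->
  Eg p (fun g => ((~~ winner t.+1 A B g v)%:R - density_limit t.+1) *
                 ((~~ winner t.+1 A B g v')%:R - density_limit t.+1)) <=
  5 * (c ^+ 2 / n%:R + c * d).
Proof.
move=> vv' vA v'A d1 d2 d3; set s := density_limit t.+1.
have s0 : 0 <= s := density_limit_ge0 _.
have s1 : s <= 1 := density_limit_le1 _.
set eta := c ^+ 2 / n%:R + c * d.
have etaE A' B' : deviation t A' B' <= d -> c ^+ 2 / n%:R + c * deviation t A' B' <= eta.
  by move=> dd; rewrite lerD2l ler_pM2l.
pose X g : R := (~~ winner t.+1 A B g v)%:R.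
pose X' g : R := (~~ winner t.+1 A B g v')%:R.
pose Y g : R := (~~ winner t.+1 (v' |: A) B g v)%:R.
pose Y' g : R := (~~ winner t.+1 (v |: A) B g v')%:R.
have vA' : v \notin v' |: A by rewrite !inE negb_or vv'.
have vA'' : v' \notin v |: A by rewrite !inE negb_or eq_sym vv'.
have mono w w' g : (~~ winner t.+1 (w' |: A) B g w)%:R <= (~~ winner t.+1 A B g w)%:R :> R.
  rewrite ler_nat; case: (boolP (winner t.+1 A B g w)) => W; last exact: leq_b1.
  by rewrite (winner_mono (subsetU1 _ _) (subxx _) W).
have b01 (b : bool) : 0 <= (b%:R : R) <= 1 by case: b; rewrite lexx ler01.
have eX : `|Eg p X - s| <= eta by apply: le_trans (etaE _ _ d1); exact: E_loser_approx.
have eX' : `|Eg p X' - s| <= eta by apply: le_trans (etaE _ _ d2); exact: E_loser_approx.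
have eY : `|Eg p Y - s| <= eta by apply: le_trans (etaE _ _ d3); exact: E_loser_approx.
have eY' : `|Eg p Y' - s| <= eta.
  apply: le_trans (etaE _ _ d3); rewrite setUCA; exact: E_loser_approx.
(* [Y] and [Y'] never exceed [X] and [X'], so each cross term costs at most a difference of means.
   The constant 5 counts one [eta] for the decoupled product and two for each difference. *)
apply: (@le_trans _ _ (Eg p (fun g => (Y g - s) * (Y' g - s)) +
   (Eg p X - Eg p Y) + (Eg p X' - Eg p Y'))).
  rewrite -!EgB -!EgD; apply: Eg_le => // g; rewrite -/(X g) -/(X' g).
  have XY : Y g <= X g := mono v v' g.
  have XY' : Y' g <= X' g := mono v' v g.
  have /andP[Y0 Y1] : 0 <= Y g <= 1 by exact: b01.
  have /andP[X0 X1] : 0 <= X' g <= 1 by exact: b01.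
  have : (X g - Y g) * (X' g - s) <= (X g - Y g) * 1 by apply: ler_wpM2l; lra.
  have : (Y g - s) * (X' g - Y' g) <= 1 * (X' g - Y' g) by apply: ler_wpM2r; lra.
  have -> : (X g - s) * (X' g - s) = (Y g - s) * (Y' g - s) +
     (X g - Y g) * (X' g - s) + (Y g - s) * (X' g - Y' g) by ring.
  lra.
have cov : Eg p (fun g => (Y g - s) * (Y' g - s)) <= eta.
  pose Q g : R := q ^+ #|losers t B (v |: (v' |: A)) g|.
  have EY : Eg p Y = Eg p Q by rewrite /Y E_loser.
  have EY' : Eg p Y' = Eg p Q by rewrite /Y' E_loser// setUCA.
  have EYY : Eg p (fun g => Y g * Y' g) = Eg p (fun g => Q g ^+ 2) by exact: E_loser2.
  (* Given the exploration, the two events are independent with the same probability [Q g], which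
     turns the product into a square. *)
  have -> : Eg p (fun g => (Y g - s) * (Y' g - s)) = Eg p (fun g => (Q g - s) ^+ 2).
    have -> : Eg p (fun g => (Y g - s) * (Y' g - s)) =
        Eg p (fun g => Y g * Y' g) - s * Eg p Y - s * Eg p Y' + s ^+ 2.
      by rewrite -!EgZ -!EgB -(Eg_cst n p (s ^+ 2)) -EgD; apply: eq_Eg => g; ring.
    rewrite EYY EY EY' -!EgZ -!EgB -(Eg_cst n p (s ^+ 2)) -EgD; apply: eq_Eg => g; ring.
  apply: le_trans (etaE _ _ d3); apply: le_trans (E_qX_approx _ _ _).
  apply: Eg_le => // g; rewrite -/(Q g) -/s -real_normK ?num_real//.
  have /andP[Q0 Q1] : 0 <= Q g <= 1.
    by case/andP: q01 => ? ?; rewrite exprn_ge0//= exprn_ile1.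
  rewrite expr2 -[leRHS]mulr1 ler_wpM2l// ler_norml; apply/andP; split; lra.
move: eX eX' eY eY'; rewrite !ler_norml => /andP[? ?] /andP[? ?] /andP[? ?] /andP[? ?].
lra.
Qed.

(** A second moment bound for the centred count of losers: the diagonal contributes at most [n], the
    other pairs are covariances. The threshold [k] converts it into a mean deviation. Covariances
    delete two more vertices, hence [r.+2]. *)
Lemma deviation_step t r (d k : R) A B : 0 < k ->
  (forall A' B', (#|A'| <= r.+2)%N -> (#|B'| <= r.+2)%N -> deviation t A' B' <= d) ->
  (#|A| <= r)%N -> (#|B| <= r)%N ->
  deviation t.+1 A B <=
  r%:R / n%:R + k + (1 / n%:R + 5 * (c ^+ 2 / n%:R + c * d)) / k.
Proof.
move=> k0 H Ar Br; set s := density_limit t.+1.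
set eta := c ^+ 2 / n%:R + c * d.
have s0 : 0 <= s := density_limit_ge0 _.
have s1 : s <= 1 := density_limit_le1 _.
have cU v (S : {set 'I_n}) : (#|v |: S| <= #|S|.+1)%N by rewrite cardsU1; case: (v \notin S).
have AU w : (#|w |: A| <= r.+1)%N by apply: leq_trans (cU _ _) _.
have AU2 w w' : (#|w |: (w' |: A)| <= r.+2)%N by apply: leq_trans (cU _ _) _; exact: AU.
have Br2 : (#|B| <= r.+2)%N by apply: (leq_trans Br); rewrite !leqW.
have d0 : 0 <= d by apply: le_trans (H set0 set0 _ _); rewrite ?cards0// deviation_ge0.
have eta0 : 0 <= eta by rewrite addr_ge0// ?divr_ge0 ?sqr_ge0 ?mulr_ge0// ltW.
pose x v g : R := (~~ winner t.+1 A B g v)%:R - s.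
pose Z g : R := \sum_(v | v \notin A) x v g.
(* The density refers to all [n] vertices while [losers] avoids [A]; the correction costs at most
   [r%:R / n%:R]. *)
have ZE g : #|losers t.+1 A B g|%:R / n%:R - s = Z g / n%:R - #|A|%:R * s / n%:R.
  have -> : Z g = #|losers t.+1 A B g|%:R - (n%:R - #|A|%:R) * s.
    rewrite /Z big_split sumr_const; congr (_ + _).
      rewrite -sum1_card natr_sum big_mkcond [RHS]big_mkcond; apply: eq_bigr => v _.
      by rewrite inE; case: (v \in A); case: (winner t.+1 A B g v).
    rewrite -natrB ?card_le_n// mulr_natl -mulNrn; congr (_ *+ _).
    have <- : #|~: A| = (n - #|A|)%N by rewrite cardsCs setCK card_ord.
    by apply: eq_card => v; rewrite !inE.
  by field; rewrite gt_eqF.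
have ZZ : Eg p (fun g => Z g ^+ 2) <= n%:R + n%:R ^+ 2 * (5 * eta).
  have -> : Eg p (fun g => Z g ^+ 2) = \sum_(v | v \notin A) \sum_(v' | v' \notin A)
      Eg p (fun g => x v g * x v' g).
    under [RHS]eq_bigr do rewrite -Eg_sum.
    rewrite -Eg_sum; apply: eq_Eg => g; rewrite expr2 {1}/Z big_distrl.
    by apply: eq_bigr => v _; rewrite big_distrr.
  apply: (@le_trans _ _ (\sum_(v : 'I_n) \sum_(v' : 'I_n) ((v == v')%:R + 5 * eta))).
    rewrite big_mkcond; apply: ler_sum => v _.
    have t0 w : 0 <= (v == w)%:R + 5 * eta by rewrite addr_ge0 ?ler0n ?mulr_ge0.
    case: ifP => vA; last by apply: sumr_ge0 => w _; exact: t0.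
    rewrite big_mkcond; apply: ler_sum => v' _; case: ifP => v'A; last exact: t0.
    case: eqVneq => [<-|vv'].
      apply: (@le_trans _ _ 1); last by rewrite lerDl mulr_ge0.
      rewrite -[leRHS](Eg_cst n p); apply: Eg_le => // g.
      rewrite /x; case: (winner t.+1 A B g v); rewrite /= ?sub0r ?mulrNN; nra.
    rewrite add0r; apply: E_loser_cov => //; apply: H => //; exact: leqW.
  rewrite (eq_bigr (fun=> 1 + n%:R * (5 * eta))).
    by rewrite sumr_const card_ord -mulr_natl; nra.
  move=> v _; rewrite big_split/= sumr_const card_ord -[X in _ + X = _]mulr_natl; congr (_ + _).
  by rewrite (bigD1 v)//= eqxx big1 ?addr0// => w; rewrite eq_sym => /negbTE ->.
(* Uses [|w| <= k + w ^+ 2 / k] for [w = Z g / n%:R], true whichever of [|w|] and [k] is larger. *)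
apply: (@le_trans _ _ (Eg p (fun g => (r%:R / n%:R + k) + (k * n%:R ^+ 2)^-1 * Z g ^+ 2))).
  apply: Eg_le => // g; rewrite -/s ZE.
  apply: (le_trans (ler_normB _ _)); rewrite [leLHS]addrC -addrA; apply: lerD.
    rewrite ger0_norm ?divr_ge0 ?mulr_ge0 ?ler0n// ler_pM2r ?invr_gt0//.
    by rewrite -[leRHS]mulr1 ler_pM ?ler0n ?ler_nat.
  set w := Z g / n%:R.
  have -> : (k * n%:R ^+ 2)^-1 * Z g ^+ 2 = `|w| ^+ 2 / k.
    by rewrite real_normK ?num_real// /w; field; rewrite !gt_eqF.
  have [wk|kw] := leP `|w| k.
    by rewrite (le_trans wk)// lerDl divr_ge0 ?exprn_ge0// ltW.
  rewrite -[leLHS]add0r lerD//; first exact: ltW.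
  by rewrite ler_pdivlMr// expr2 ler_wpM2l// ltW.
rewrite EgD EgZ Eg_cst lerD2l mulrC.
rewrite -/eta; have -> : (1 / n%:R + 5 * eta) / k =
   (n%:R + n%:R ^+ 2 * (5 * eta)) * (k * n%:R ^+ 2)^-1.
  by field; rewrite !gt_eqF.
by rewrite ler_pM2r// invr_gt0 mulr_gt0// exprn_gt0.
Qed.

Lemma deviation0 r A B : (#|A| <= r)%N -> deviation 0 A B <= r%:R / n%:R.
Proof.
move=> Ar; rewrite -[leRHS](Eg_cst n p); apply: Eg_le => // g.
have -> : #|losers 0 A B g| = (n - #|A|)%N.
  have <- : #|~: A| = (n - #|A|)%N by rewrite cardsCs setCK card_ord.
  by apply: eq_card => v; rewrite !inE andbT.
rewrite natrB ?card_le_n// mulrBl mulfV ?gt_eqF// addrAC subrr sub0r normrN.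
by rewrite ger0_norm ?divr_ge0 ?ler0n// ler_pM2r ?invr_gt0// ler_nat.
Qed.

End Concentration.

(** * Expected size of the cover *)

Section CoverExpectation.
Variables (R : realType) (n : nat) (c : R).
Hypotheses (n0 : (0 < n)%N) (c0 : 0 < c) (cn : c < n%:R).
Let p : R := c / n%:R.
Let q : R := 1 - p.
Implicit Types (g : bigraph n) (x y : 'I_n).

Let nR : 0 < n%:R :> R. Proof. by rewrite ltr0n. Qed.
Let p0 : 0 < p. Proof. by rewrite divr_gt0. Qed.
Let p1 : p < 1. Proof. by rewrite ltr_pdivrMr// mul1r. Qed.
Let p01 : 0 <= p <= 1. Proof. by rewrite !ltW. Qed.
Let q01 : 0 <= q <= 1. Proof. by rewrite /q; move: p0 p1 => ? ?; lra. Qed.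

(** To have [y] as the only neighbour in [S] is to miss [S :\ y] but not [S]; the event is thus
    reduced to absences of edges. *)
Lemma at_most_one_nbr (S : {set 'I_n}) g x :
  (#|[set y in S | (x, y) \in g]| <= 1)%N%:R =
  [disjoint setX [set x] S & g]%:R +
  \sum_(y in S) ([disjoint setX [set x] (S :\ y) & g]%:R -
                 [disjoint setX [set x] S & g]%:R) :> R.
Proof.
set N := [set y in S | _].
have disjE (S' : {set 'I_n}) : S' \subset S -> [disjoint setX [set x] S' & g] = (N :&: S' == set0).
  move=> /subsetP S'S; rewrite -setI_eq0; apply/eqP/eqP => /setP E; apply/setP.
    move=> y; have := E (x, y); rewrite !inE eqxx/=.
    by case: (boolP (y \in S')) => [/S'S -> /= ->//|]; rewrite andbF.
  move=> [x' y]; have := E y; rewrite !inE/=; case: eqVneq => // ->.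
  by case: (boolP (y \in S')) => [/S'S -> /=|//]; rewrite andbT.
have NS : N \subset S by apply/subsetP => y; rewrite inE => /andP[].
rewrite (disjE S)// (setIidPl NS).
rewrite (eq_bigr (fun y => (N :\ y == set0)%:R - (N == set0)%:R)); last first.
  move=> y yS; rewrite disjE ?subD1set//; congr ((nat_of_bool (_ == _))%:R - _).
  by apply/setP => z; rewrite !inE; case: (z \in S); rewrite ?andbF// andbT andbC.
have [N0|] := eqVneq N set0.
  rewrite N0 cards0 big1 ?addr0// => y _.
  by rewrite set0D eqxx subrr.
move=> /set0Pn[y yN]; rewrite add0r.
have yS := subsetP NS y yN.
have [N1|N1] := leqP #|N| 1.
  have {}N1 : N = [set y].
    by apply/setP => z; rewrite inE; apply/idP/eqP => [zN|->//]; exact: (card_le1_eqP N1).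
  rewrite (bigD1 y)//= N1 setDv eqxx subr0 big1 ?addr0// => z /andP[_ zy].
  rewrite subr0 (_ : _ == _ = false)//; apply/negP => /eqP/setP/(_ y).
  by rewrite !inE eqxx eq_sym (negbTE zy).
rewrite big1// => z _; rewrite subr0 (_ : _ == _ = false)//.
apply/negP => /eqP E; move: N1; rewrite (cardsD1 z) E cards0 addn0.
by case: (z \in N).
Qed.

(** Given L losers, the number of them adjacent to [x] is binomial and is at most one with
    probability q^L + L p q^(L-1). Lowering q^(L-1) to q^L gives the stated form, as p = c/n. *)
Lemma E_not_cover_left k x :
  Eg p (fun g => (x \notin cover_left k g)%:R) >=
  Eg p (fun g => q ^+ #|losers k.*2 set0 (x |: set0) g| *
    (1 + c * (#|losers k.*2 set0 (x |: set0) g|%:R / n%:R))).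
Proof.
rewrite -[leLHS]Eg_transpose.
pose S g := losers k.*2 set0 (x |: set0) (transpose_graph g).
pose Q : bigraph n := setX [set x] setT.
have SQ g e : e \in Q -> S (g :\ e) = S g.
  case: e => a b; rewrite !inE/= andbT => /eqP ->.
  by rewrite /S losers_remove// !inE eqxx.
have dE (F : bigraph n -> R) (S' : bigraph n -> {set 'I_n}) :
    (forall g e, e \in Q -> F (g :\ e) = F g) ->
    (forall g e, e \in Q -> S' (g :\ e) = S' g) ->
    Eg p (fun g => F g * [disjoint setX [set x] (S' g) & g]%:R) =
    Eg p (fun g => F g * q ^+ #|S' g|).
  move=> FQ S'Q.
  rewrite (@Eg_disjoint_random _ _ _ Q (fun g => setX [set x] (S' g)))//.
  - by apply: eq_Eg => g; rewrite cardsX cards1 mul1n.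
  - by move=> g; apply/subsetP => -[a b]; rewrite !inE => /andP[->].
  - by move=> g e eQ; rewrite S'Q.
have -> : Eg p (fun g => (x \notin cover_left k g)%:R) = Eg p (fun g =>
    1 * [disjoint setX [set x] (S g) & g]%:R +
    \sum_(y : 'I_n) ((y \in S g)%:R * [disjoint setX [set x] (S g :\ y) & g]%:R -
                     (y \in S g)%:R * [disjoint setX [set x] (S g) & g]%:R)).
  apply: eq_Eg => g; rewrite inE -leqNgt at_most_one_nbr mul1r; congr (_ + _).
  rewrite big_mkcond; apply: eq_bigr => y _; rewrite -/(S g).
  by case: (y \in S g); rewrite ?mul1r ?mul0r ?subrr.
have yS y g e : e \in Q -> ((y \in S (g :\ e))%:R = (y \in S g)%:R :> R).
  by move=> /SQ ->.
rewrite EgD Eg_sum dE//; under eq_bigr => y _.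
  rewrite EgB dE//; last 2 first.
  - exact: yS.
  - by move=> g e /SQ ->.
  rewrite dE//; last by exact: yS.
  rewrite -EgB.
  over.
rewrite -Eg_sum -EgD; apply: Eg_le => // g; rewrite -/(S g).
rewrite (eq_bigr (fun y => (y \in S g)%:R * (p * q ^+ #|S g|.-1))); last first.
  move=> y _; case: (boolP (y \in S g)) => yS'; last by rewrite !mul0r subrr.
  have := cardsD1 y (S g); rewrite yS' add1n => ->.
  by rewrite /= exprS /q; ring.
rewrite -big_distrl/=.
have -> : \sum_(y : 'I_n) (y \in S g)%:R = #|S g|%:R :> R.
  by rewrite -sum1_card natr_sum [RHS]big_mkcond; apply: eq_bigr => y _; case: (y \in S g).
case: #|S g| => [|m] /=; first by rewrite expr0 !mulr0n !(mul0r, mulr0) !addr0.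
rewrite mulrDr mulr1 mul1r lerD2l.
have -> : m.+1%:R * (p * q ^+ m) = q ^+ m * (c * (m.+1%:R / n%:R)) by rewrite /p; ring.
case/andP: q01 => q0 q1.
apply: ler_wpM2r; first by rewrite mulr_ge0 ?divr_ge0 ?ler0n// ltW.
by rewrite exprS -[leRHS]mul1r ler_wpM2r// exprn_ge0.
Qed.

(** A bin escapes the cover with probability at least [s1 * (1 + c * s0)] up to
    [(1 + c) * eta + c * d], a ball with probability at least [s2] up to [eta]. *)
Lemma E_max_le_cover k (d : R) :
  (forall x : 'I_n, deviation c k.*2 set0 (x |: set0) <= d) ->
  (forall x : 'I_n, deviation c k.*2.+1 set0 (x |: set0) <= d) ->
  E_max_matching n p <= n%:R *
    (2 - density_limit c k.*2.+2
       - density_limit c k.*2.+1 * (1 + c * density_limit c k.*2)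
       + (2 + c) * (c ^+ 2 / n%:R + c * d) + c * d).
Proof.
move=> dl dr; set s2 := density_limit c k.*2.+2; set s1 := density_limit c k.*2.+1.
set s0 := density_limit c k.*2; set eta := c ^+ 2 / n%:R + c * d.
have s00 : 0 <= s0 := density_limit_ge0 _ _.
have s01 : s0 <= 1 := density_limit_le1 c0 _.
have left x : Eg p (fun g => (x \in cover_left k g)%:R) <=
    1 - s1 * (1 + c * s0) + (1 + c) * eta + c * d.
  have -> : Eg p (fun g => (x \in cover_left k g)%:R) =
      1 - Eg p (fun g => (x \notin cover_left k g)%:R).
    rewrite -[X in _ = X - _](Eg_cst n p 1) -EgB; apply: eq_Eg => g.
    by case: (x \in cover_left k g); rewrite /= ?subr0 ?subrr.
  suff : s1 * (1 + c * s0) - (1 + c) * eta - c * d <=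
      Eg p (fun g => (x \notin cover_left k g)%:R) by lra.
  apply: le_trans (E_not_cover_left k x).
  pose M g : R := #|losers k.*2 set0 (x |: set0) g|%:R / n%:R.
  pose Qm g : R := q ^+ #|losers k.*2 set0 (x |: set0) g|.
  have EQ : Eg p (fun g => `|Qm g - s1|) <= eta.
    apply: (le_trans (E_qX_approx n0 c0 cn _ _ _)).
    by rewrite lerD2l ler_pM2l.
  have EM : Eg p (fun g => `|M g - s0|) <= d by exact: dl.
  apply: (@le_trans _ _ (Eg p (fun g => s1 * (1 + c * s0) -
      ((1 + c) * `|Qm g - s1| + c * `|M g - s0|)))).
    rewrite EgB EgD !EgZ Eg_cst -addrA -opprD lerD2l lerN2; apply: lerD.
      by rewrite ler_pM2l ?addr_gt0//; exact: EQ.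
    by rewrite ler_pM2l//; exact: EM.
  apply: Eg_le => // g; rewrite -/(Qm g) -/(M g).
  have /andP[Q0 Q1] : 0 <= Qm g <= 1.
    by case/andP: q01 => ? ?; rewrite exprn_ge0//= exprn_ile1.
  (* One factor changes at a time, so that [s0 <= 1] and [Qm g <= 1] bound the multipliers. *)
  have -> : Qm g * (1 + c * M g) = s1 * (1 + c * s0) +
      ((Qm g - s1) * (1 + c * s0) + c * (Qm g * (M g - s0))) by ring.
  rewrite lerD2l opprD; apply: lerD.
    rewrite lerNl -mulNr; apply: (le_trans (ler_norm _)).
    have cs0 : 0 <= 1 + c * s0 by rewrite addr_ge0// mulr_ge0// ltW.
    rewrite normrM normrN mulrC ler_wpM2r// (ger0_norm cs0).
    by rewrite lerD2l -[leRHS]mulr1 ler_pM2l.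
  rewrite -mulrN ler_pM2l// lerNl -mulrN; apply: (le_trans (ler_norm _)).
  by rewrite normrM normrN (ger0_norm Q0) -[leRHS]mul1r ler_wpM2r.
have right y : Eg p (fun g => (y \in cover_right k g)%:R) <= 1 - s2 + eta.
  have -> : Eg p (fun g => (y \in cover_right k g)%:R) =
      1 - Eg p (fun g => (~~ winner k.*2.+2 set0 set0 g y)%:R).
    rewrite -[in RHS]Eg_transpose -[X in _ = X - _](Eg_cst n p 1) -EgB; apply: eq_Eg => g.
    by rewrite inE; case: (winner k.*2.+2 set0 set0 (transpose_graph g) y);
      rewrite ?subr0 ?subrr.
  have y0 : y \notin set0 by rewrite inE.
  have := E_loser_approx n0 c0 cn k.*2.+1 set0 y0.
  rewrite -/p -/s2 ler_norml => /andP[+ _].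
  have : c ^+ 2 / n%:R + c * deviation c k.*2.+1 set0 (y |: set0) <= eta.
    by rewrite lerD2l ler_pM2l.
  lra.
apply: (@le_trans _ _ (Eg p (fun g => \sum_(x : 'I_n)
    ((x \in cover_left k g)%:R + (x \in cover_right k g)%:R)))).
  apply: Eg_le => // g; rewrite big_split/=.
  have cE (S : {set 'I_n}) : \sum_(x : 'I_n) (x \in S)%:R = #|S|%:R :> R.
    by rewrite -sum1_card natr_sum [RHS]big_mkcond; apply: eq_bigr => x _; case: (x \in S).
  by rewrite !cE -natrD ler_nat max_matching_le_cover.
rewrite Eg_sum; set b := (X in _ <= _ * X).
apply: (@le_trans _ _ (\sum_(x : 'I_n) b)); last first.
  by rewrite sumr_const card_ord mulr_natl.
apply: ler_sum => x _; rewrite EgD; have := left x; have := right x.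
rewrite /b; lra.
Qed.

End CoverExpectation.

(** * Large [n] at fixed depth, then large depth *)

Section Asymptotics.
Variable R : realType.

Lemma div_nat_small (a e : R) : 0 < e ->
  exists N, forall n, (N <= n)%N -> (0 < n)%N /\ a / n%:R < e.
Proof.
move=> e0; exists (Num.bound `|a / e|).+1 => n Nn.
have n0 : (0 < n)%N by exact: leq_trans Nn.
split=> //; rewrite ltr_pdivrMr ?ltr0n// mulrC -ltr_pdivrMr//.
apply: (le_lt_trans (ler_norm _)); apply: (lt_le_trans (archi_boundP (normr_ge0 _))).
by rewrite ler_nat ltnW.
Qed.

(** Induction on the depth for all [r] at once, because each round asks for a smaller deviation with
    two more deleted vertices. *)
Lemma deviation_small (c : R) t : 0 < c -> forall r (e : R), 0 < e ->
  exists N, forall n, (N <= n)%N -> forall A B : {set 'I_n},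
    (#|A| <= r)%N -> (#|B| <= r)%N -> deviation c t A B <= e.
Proof.
move=> c0.
have [N1 H1] := div_nat_small c (@ltr01 R).
have {}H1 n : (N1 <= n)%N -> (0 < n)%N /\ c < n%:R.
  by move=> /H1[n0]; rewrite ltr_pdivrMr ?ltr0n// mul1r.
elim: t => [|t IH] r e e0.
  have [N2 H2] := div_nat_small r%:R e0.
  exists (maxn N1 N2) => n; rewrite geq_max => /andP[/H1[n0 cn1] /H2[_ re]] A B Ar Br.
  exact: le_trans (deviation0 n0 c0 cn1 _ Ar) (ltW re).
(* These make [k] and [5 * c * d / k] equal to [e / 4] each; the terms in 1/n take the remaining
   half. *)
pose k := e / 4; pose d := e ^+ 2 / (80 * c).
have k0 : 0 < k by rewrite divr_gt0.
have d0 : 0 < d by rewrite divr_gt0 ?exprn_gt0 ?mulr_gt0.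
have [N2 H2] := IH r.+2 d d0.
have e2 : 0 < e / 2 by rewrite divr_gt0.
have [N3 H3] := div_nat_small (r%:R + (1 + 5 * c ^+ 2) / k) e2.
exists (maxn N1 (maxn N2 N3)) => n.
rewrite !geq_max => /and3P[/H1[n0 cn1] /H2{}H2 /H3[_ re]] A B Ar Br.
apply: (le_trans (deviation_step n0 c0 cn1 k0 H2 Ar Br)).
have nR : 0 < n%:R :> R by rewrite ltr0n.
have -> : r%:R / n%:R + k + (1 / n%:R + 5 * (c ^+ 2 / n%:R + c * d)) / k =
    (r%:R + (1 + 5 * c ^+ 2) / k) / n%:R + e / 2.
  by rewrite /k /d; field; rewrite !gt_eqF.
lra.
Qed.

Section GammaLimit.
Variables (c : R) (c0 : 0 < c).

Let a k : R := c * density_limit c k.*2.+1.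
Let F (x : R) : R := c * expR (- c * expR (- x)).

Let aS k : a k.+1 = F (a k).
Proof. by rewrite /a /F doubleS [density_limit c _]/= mulNr. Qed.

Let F_mono x y : x <= y -> F x <= F y.
Proof.
by move=> xy; rewrite ler_pM2l// ler_expR !mulNr lerN2 ler_pM2l// ler_expR lerN2.
Qed.

Let a0E : a 0 = F 0.
Proof. by rewrite /a /F /= oppr0 expR0 mulNr. Qed.

Let a_le k : a k <= gamma_low c.
Proof.
have [gr _] := gamma_lowP c0.
elim: k => [|k IH]; rewrite ?aS ?a0E; rewrite [leRHS]gr; apply: F_mono => //.
by rewrite gr mulr_ge0 ?expR_ge0// ltW.
Qed.

Let a_nd : {homo a : i j / (i <= j)%N >-> i <= j}.
Proof.
apply: homo_leq => //; first exact: le_trans.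
elim=> [|k IH]; rewrite !aS ?a0E; apply: F_mono => //; last by rewrite -aS.
by rewrite mulr_ge0 ?expR_ge0// ltW.
Qed.

Local Open Scope classical_set_scope.
Local Open Scope ring_scope.

(** The iterates of the monotone map [F] from 0 increase and stay below [gamma_low c]. By continuity
    their limit is a root, hence the smallest one. *)
Lemma odd_density_limit : c * density_limit c k.*2.+1 @[k --> \oo] --> gamma_low c.
Proof.
have [gr gmin] := gamma_lowP c0.
have acvg : cvgn a.
  apply: nondecreasing_is_cvgn; first exact: a_nd.
  by exists (gamma_low c) => _ [k _ <-].
have Fl : F (a k) @[k --> \oo] --> F (limn a).
  have e (u : nat -> R) l : u @ \oo --> l -> expR (u k) @[k --> \oo] --> expR l.
    by apply: continuous_cvg; exact: continuous_expR.
  by apply: cvgMr; apply: (e _ _); apply: cvgMr; apply: (e _ _); exact: cvgN.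
have aSl : a k.+1 @[k --> \oo] --> limn a by rewrite (cvg_shiftS a).
have root : limn a = F (limn a).
  have aSF : (fun k => a k.+1) = (fun k => F (a k)) by apply/funext => k; exact: aS.
  by apply: (cvg_unique (@Rhausdorff R) aSl); rewrite aSF; exact: Fl.
have -> : gamma_low c = limn a; last exact: acvg.
apply/eqP; rewrite eq_le (gmin _ root) /=.
by apply: limr_le => //; apply: nearW => k; exact: a_le.
Qed.

End GammaLimit.

End Asymptotics.

(** * Limiting size of the cover per ball *)

Section Ratio.
Variable R : realType.

(** The limiting expected size of the cover divided by [n]; multiplied by [c] it is the denominator
    of case (ii). *)
Definition max_density (c : R) : R :=
  (2 * c - (gamma_upp c + gamma_low c + gamma_upp c * gamma_low c)) / c.

Local Open Scope classical_set_scope.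
Local Open Scope ring_scope.

(** From [k.+1] on, each even-depth term is the exponential of an odd-depth one, so everything is a
    continuous function of odd-depth terms; the shift excludes depth 0. *)
Lemma cover_density_cvg (c : R) : 0 < c ->
  (2 - density_limit c k.+1.*2.+2
     - density_limit c k.+1.*2.+1 * (1 + c * density_limit c k.+1.*2))
  @[k --> \oo] --> max_density c.
Proof.
move=> c0; have cn0 : c != 0 by rewrite gt_eqF.
have a1 := odd_density_limit c0.
have a2 : c * density_limit c k.+1.*2.+1 @[k --> \oo] --> gamma_low c.
  by rewrite (cvg_shiftS (fun k => c * density_limit c k.*2.+1)).
have e (u : nat -> R) l : u @ \oo --> l -> expR (- u k) @[k --> \oo] --> expR (- l).
  by move=> ul; apply: (@continuous_cvg _ _ _ _ _ (fun k => - u k));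
    [exact: continuous_expR|exact: cvgN].
have -> : max_density c = 2 - expR (- gamma_low c) -
    c^-1 * gamma_low c * (1 + c * expR (- gamma_low c)).
  by rewrite /max_density /gamma_upp; field.
have -> : (fun k => 2 - density_limit c k.+1.*2.+2
     - density_limit c k.+1.*2.+1 * (1 + c * density_limit c k.+1.*2)) =
  (fun k => 2 - expR (- (c * density_limit c k.+1.*2.+1)) -
     c^-1 * (c * density_limit c k.+1.*2.+1) *
       (1 + c * expR (- (c * density_limit c k.*2.+1)))).
  by apply/funext => k; rewrite mulKf.
apply: cvgB; first by apply: cvgB; [exact: cvg_cst|exact: e].
apply: cvgM; first exact: cvgMr.
by apply: cvgD; [exact: cvg_cst|apply: cvgMr; exact: e].
Qed.

(** The depth [k] is fixed first, close enough to the limit, and only then does [n] grow. *)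
Lemma E_max_upper (c e : R) : 0 < c -> 0 < e ->
  exists N, forall n, (N <= n)%N ->
    E_max_matching n (c / n%:R) <= n%:R * (max_density c + e).
Proof.
move=> c0 e0.
have e2 : 0 < e / 2 by rewrite divr_gt0.
have e4 : 0 < e / 4 by rewrite divr_gt0.
have [k Bk] : exists k, 2 - density_limit c k.*2.+2
     - density_limit c k.*2.+1 * (1 + c * density_limit c k.*2) <= max_density c + e / 2.
  have /cvgrPdist_le/(_ _ e2)[K _ /(_ K (leqnn K))] := cover_density_cvg c0.
  by rewrite ler_distlC => /andP[_ h]; exists K.+1; exact: h.
(* The error contains [d] with total weight [(3 + c) * c], so it amounts to [e / 4]; the term in 1/n
   gets another [e / 4]. *)
pose d := e / 4 / ((3 + c) * c).
have d0 : 0 < d by rewrite divr_gt0// mulr_gt0// addr_gt0.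
have [N1 H1] := div_nat_small c (@ltr01 R).
have [N2 H2] := deviation_small k.*2 c0 1 d0.
have [N3 H3] := deviation_small k.*2.+1 c0 1 d0.
have [N4 H4] := div_nat_small ((2 + c) * c ^+ 2) e4.
exists (maxn (maxn N1 N2) (maxn N3 N4)) => n; rewrite !geq_max.
move=> /andP[/andP[/H1[n0 cn] /H2{}H2] /andP[/H3{}H3 /H4[_ {}H4]]].
have nR : 0 < n%:R :> R by rewrite ltr0n.
have {}cn : c < n%:R by move: cn; rewrite ltr_pdivrMr// mul1r.
have card1 (x : 'I_n) : (#|x |: set0| <= 1)%N by rewrite cardsU1 cards0 inE.
have card0 : (#|set0 : {set 'I_n}| <= 1)%N by rewrite cards0.
have := @E_max_le_cover _ n c n0 c0 cn k d
  (fun x => H2 _ _ card0 (card1 x)) (fun x => H3 _ _ card0 (card1 x)).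
move=> /le_trans; apply; rewrite ler_pM2l//.
have dE : (3 + c) * c * d = e / 4.
  by rewrite /d mulrC divfK// gt_eqF// mulr_gt0// addr_gt0.
have -> : (2 + c) * (c ^+ 2 / n%:R + c * d) = (2 + c) * c ^+ 2 / n%:R + (2 + c) * c * d.
  by ring.
have : (2 + c) * c * d + c * d = e / 4 by rewrite -dE; ring.
lra.
Qed.

(** Holds because [w * (2 - w)] is [1 - (1 - w) ^+ 2]. It bounds the numerator of greedy at
    [w = q ^+ n] and at [w = expR (- c)]. *)
Lemma ln_sub_square (w : R) : 0 < w < 1 -> (1 - w) ^+ 2 <= - ln w - ln (2 - w).
Proof.
move=> /andP[w0 w1].
rewrite -opprD -lnM ?posrE//; last lra.
have -> : w * (2 - w) = 1 + - (1 - w) ^+ 2 by ring.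
by rewrite lerNr le_ln1Dx// ltrN2 expr_lt1//; lra.
Qed.

(** * Greedy at fixed [n]: the dense and sparse bounds *)

Section FixedSize.
Variables (n : nat) (p : R).
Hypotheses (n0 : (0 < n)%N) (p01 : 0 < p < 1).
Let q : R := 1 - p.
Let nR : 0 < n%:R :> R. Proof. by rewrite ltr0n. Qed.
Let p0 : 0 < p. Proof. by case/andP: p01. Qed.
Let q0 : 0 < q. Proof. by rewrite subr_gt0; case/andP: p01. Qed.
Let q1 : q < 1. Proof. by rewrite /q; move: p0 => ?; lra. Qed.

Lemma opp_ln_ge : p <= - ln q.
Proof. by rewrite lerNr le_ln1Dx// ltrN2; case/andP: p01. Qed.

Lemma opp_ln_le : - ln q <= p / q.
Proof.
rewrite -lnV ?posrE// [X in ln X](_ : _ = 1 + p / q); last by rewrite /q; field; rewrite gt_eqF.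
by rewrite le_ln1Dx// (lt_trans (ltrN10 R))// divr_gt0.
Qed.

(** For the dense regime: the logarithm of a number below 2 is at most 1 and [- ln q] is at least
    [p], so at most [p^-1] balls are lost on average. *)
Lemma E_greedy_ge_inv : n%:R - p^-1 <= E_greedy n p.
Proof.
apply: le_trans (E_greedy_ge n p01); rewrite -/q lerD2l lerN2.
have qn0 : 0 < q ^+ n by exact: exprn_gt0.
have qn1 : q ^+ n < 1 by rewrite exprn_ilt1// ?ltW// -lt0n.
have ln1 : ln (2 - q ^+ n) <= 1.
  rewrite (_ : 2 - q ^+ n = 1 + (1 - q ^+ n)); last by ring.
  by apply: (le_trans (le_ln1Dx _)); lra.
have := opp_ln_ge => pl; have l0 : 0 < - ln q by exact: lt_le_trans pl.
rewrite -[leRHS]mul1r; apply: ler_pM => //.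
- by rewrite ln_ge0//; lra.
- by rewrite invr_ge0 ltW.
- by rewrite lef_pV2 ?posrE.
Qed.

(** For the sparse regime: [n%:R * n%:R * p] is the expected number of edges, which bounds the
    maximum matching, and the last factor tends to 1. *)
Lemma E_greedy_ge_sparse : n%:R * p <= 1 ->
  n%:R * n%:R * p * (1 - 3 * (n%:R * p)) <= E_greedy n p.
Proof.
move=> np1; apply: le_trans (E_greedy_ge n p01); rewrite -/q.
have qn0 : 0 < q ^+ n by exact: exprn_gt0.
have qn1 : q ^+ n < 1 by rewrite exprn_ilt1// ?ltW// -lt0n.
have := opp_ln_ge => pl; have l0 : 0 < - ln q by exact: lt_le_trans pl.
have h := ln_sub_square (introT andP (conj qn0 qn1)).
have np0 : 0 < n%:R * p by exact: mulr_gt0.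
have -> : n%:R - ln (2 - q ^+ n) / - ln q = (- ln (q ^+ n) - ln (2 - q ^+ n)) / - ln q.
  by rewrite lnXn// -mulr_natl; field; rewrite -oppr_eq0 gt_eqF.
have y1 : n%:R * p * (1 - n%:R * p) <= 1 - q ^+ n.
  have : q ^+ n <= expR (- (n%:R * p)).
    rewrite (_ : - (n%:R * p) = - p * n%:R); last by ring.
    rewrite expRM_natr; apply: lerXn2r; rewrite ?nnegrE ?expR_ge0//; first exact: ltW.
    exact: expR_ge1Dx.
  have := expRN_lin (ltW np0); rewrite ler_norml => /andP[+ _].
  nra.
(* The square comes from [ln_sub_square] and [p / q] from [opp_ln_le]. With [z = n%:R * p] and
   [p <= z], what is left is [(1 - z) ^+ 3 >= 1 - 3 * z]. *)
apply: (@le_trans _ _ ((n%:R * p * (1 - n%:R * p)) ^+ 2 / (p / q))).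
  rewrite invf_div.
  have -> : (n%:R * p * (1 - n%:R * p)) ^+ 2 * (q / p) =
      n%:R * n%:R * p * ((1 - n%:R * p) ^+ 2 * q) by field; rewrite gt_eqF.
  rewrite ler_pM2l ?mulr_gt0// /q.
  have pnp : p <= n%:R * p by apply: ler_peMl; [exact: ltW|rewrite ler1n].
  set z := n%:R * p in np1 np0 pnp *.
  have z2 : 0 <= (1 - z) ^+ 2 by exact: sqr_ge0.
  have : (1 - z) ^+ 2 * (1 - z) <= (1 - z) ^+ 2 * (1 - p) by rewrite ler_wpM2l//; lra.
  move=> /(le_trans _); apply; rewrite -subr_ge0.
  have -> : (1 - z) ^+ 2 * (1 - z) - (1 - 3 * z) = z ^+ 2 * (3 - z) by ring.
  by rewrite mulr_ge0 ?sqr_ge0//; lra.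
apply: ler_pM.
- exact: sqr_ge0.
- by rewrite invr_ge0 divr_ge0// ltW.
- apply: le_trans h; rewrite lerXn2r ?nnegrE//; last lra.
  by rewrite mulr_ge0 ?(ltW np0)// subr_ge0.
- by rewrite lef_pV2 ?posrE ?divr_gt0// opp_ln_le.
Qed.

End FixedSize.

(** * Comparison of greedy with the cover for p = c/n *)

Definition greedy_density (c : R) : R := (c - ln (2 - expR (- c))) / c.

Lemma greedy_density_gt0 (c : R) : 0 < c -> 0 < greedy_density c.
Proof.
move=> c0; rewrite divr_gt0//.
have w1 : expR (- c) < 1 by rewrite -expR0 ltr_expR oppr_lt0.
have := @ln_sub_square (expR (- c)); rewrite expR_gt0 w1 expRK opprK => /(_ isT).
by apply: lt_le_trans; rewrite exprn_gt0// subr_gt0.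
Qed.

(** Replacing [q ^+ n] by [expR (- c)] costs at most [c ^+ 2 / n%:R], and the logarithm is
    1-Lipschitz above 1; division by p = c/n turns this into a loss of [c] balls in all. *)
Lemma E_greedy_ge_density (n : nat) (c : R) : (0 < n)%N -> 0 < c -> c < n%:R ->
  n%:R * (greedy_density c - c / n%:R) <= E_greedy n (c / n%:R).
Proof.
move=> n0 c0 cn; set p := c / n%:R; set q := 1 - p.
have nR : 0 < n%:R :> R by rewrite ltr0n.
have p01 : 0 < p < 1 by rewrite divr_gt0//= ltr_pdivrMr// mul1r.
apply: le_trans (E_greedy_ge n p01); rewrite -/q.
have := opp_ln_ge p01; rewrite -/q => pl.
case/andP: p01 => p0 p1.
have l0 : 0 < - ln q by exact: lt_le_trans pl.
have q01 : 0 <= q <= 1 by rewrite /q; lra.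
have qn1 : q ^+ n <= 1 by case/andP: q01 => ? ?; rewrite exprn_ile1.
have qn0 : 0 <= q ^+ n by case/andP: q01 => ? ?; rewrite exprn_ge0.
have w1 : expR (- c) < 1 by rewrite -expR0 ltr_expR oppr_lt0.
have close : 2 - q ^+ n <= 2 - expR (- c) + c ^+ 2 / n%:R.
  have := qX_approx n0 c0 cn (leqnn n).
  rewrite -/p -/q divff ?gt_eqF// mulr1 ler_norml => /andP[]; lra.
set x := 2 - expR (- c) in close *; set y := 2 - q ^+ n in close *.
have x1 : 1 < x by rewrite /x; lra.
have y1 : 1 <= y by rewrite /y; lra.
have lny : ln y <= ln x + c ^+ 2 / n%:R.
  have -> : ln y = ln x + ln (1 + (y / x - 1)).
    rewrite -lnM ?posrE; [congr ln; field; rewrite gt_eqF//| | ]; try lra.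
    by rewrite addrC subrK divr_gt0; lra.
  rewrite lerD2l; apply: (le_trans (le_ln1Dx _)).
    by rewrite ltrBDl subrr divr_gt0; lra.
  rewrite lerBlDr ler_pdivrMr; last lra.
  have : 0 <= c ^+ 2 / n%:R by rewrite divr_ge0 ?sqr_ge0 ?ltW.
  by set u := c ^+ 2 / n%:R in close *; nra.
have lnl : ln y / - ln q <= ln y / p.
  by rewrite ler_wpM2l ?ln_ge0// lef_pV2 ?posrE.
have -> : n%:R * (greedy_density c - c / n%:R) = n%:R - (ln x + c ^+ 2 / n%:R) / p.
  by rewrite /greedy_density -/x /p; field; rewrite !gt_eqF.
rewrite lerD2l lerN2; apply: (le_trans lnl).
by rewrite ler_pM2r ?invr_gt0.
Qed.

(** Follows from comparing the two expectations for large [n] rather than the two formulas. It makes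
    [max_density c] positive, so that the quotient behaves as expected. *)
Lemma greedy_le_max_density (c : R) : 0 < c -> greedy_density c <= max_density c.
Proof.
move=> c0; apply/ler_addgt0Pr => e e0.
have e2 : 0 < e / 2 by rewrite divr_gt0.
have [N1 H1] := E_max_upper c0 e2.
have [N2 H2] := div_nat_small c (@ltr01 R).
have [N3 H3] := div_nat_small c e2.
pose n := maxn N1 (maxn N2 N3).
have := H1 n (leq_maxl _ _).
have [n0 cn] := H2 n (leq_trans (leq_maxl _ _) (leq_maxr _ _)).
have [_ ce] := H3 n (leq_trans (leq_maxr _ _) (leq_maxr _ _)).
have nR : 0 < n%:R :> R by rewrite ltr0n.
have p01 : 0 < c / n%:R < 1 by rewrite divr_gt0.
have {}cn : c < n%:R by move: cn; rewrite ltr_pdivrMr// mul1r.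
have := le_trans (E_greedy_ge_density n0 c0 cn) (E_greedy_le_max n p01).
move=> /le_trans h /h; rewrite ler_pM2l//; lra.
Qed.

Lemma greedy_ratio_lower (c r : R) : 0 < c -> 0 < r ->
  r * max_density c < greedy_density c ->
  exists N, forall n, (N <= n)%N ->
    r <= E_greedy n (c / n%:R) / E_max_matching n (c / n%:R).
Proof.
move=> c0 r0 rab.
have r1 : 0 < 1 + r by rewrite addr_gt0.
(* [d] solves [greedy_density c - d = r * (max_density c + d)]: it is the slack that either bound
   may lose. *)
pose d := (greedy_density c - r * max_density c) / (1 + r).
have d0 : 0 < d by rewrite divr_gt0// subr_gt0.
have dE : (1 + r) * d = greedy_density c - r * max_density c.
  by rewrite /d mulrC divfK// gt_eqF.
have b0 : 0 < max_density c.
  exact: lt_le_trans (greedy_density_gt0 c0) (greedy_le_max_density c0).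
have [N1 H1] := E_max_upper c0 d0.
have [N2 H2] := div_nat_small c (@ltr01 R).
have [N3 H3] := div_nat_small c d0.
exists (maxn N1 (maxn N2 N3)) => n.
rewrite !geq_max => /and3P[/H1{}H1 /H2[n0 cn] /H3[_ ce]].
have nR : 0 < n%:R :> R by rewrite ltr0n.
have p01 : 0 < c / n%:R < 1 by rewrite divr_gt0.
have {}cn : c < n%:R by move: cn; rewrite ltr_pdivrMr// mul1r.
have G := E_greedy_ge_density n0 c0 cn.
have rM : r * E_max_matching n (c / n%:R) <= E_greedy n (c / n%:R).
  apply: le_trans G; apply: (@le_trans _ _ (r * (n%:R * (max_density c + d)))).
    by rewrite ler_pM2l.
  rewrite mulrCA ler_pM2l//; nra.
have M0 : 0 < E_max_matching n (c / n%:R).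
  apply: lt_le_trans (E_greedy_le_max n p01); apply: lt_le_trans G.
  rewrite mulr_gt0//; nra.
by rewrite ler_pdivlMr.
Qed.

End Ratio.

(** * Limits of the ratio and the three regimes *)

Local Open Scope classical_set_scope.
Local Open Scope ring_scope.

Lemma le_limn_einf (R : realType) (u : nat -> R) (L : R) :
  (forall r, r < L -> \forall n \near \oo, r <= u n) ->
  (L%:E <= limn_einf (fun n => (u n)%:E))%E.
Proof.
move=> uL; apply/lee_addgt0Pr => e e0.
rewrite -leeBlDr//.
have /uL[N _ HN] : L - e < L by rewrite ltrBlDr ltrDl.
rewrite limn_einf_lim.
(* Tail infima are nondecreasing, so a single one already bounds their limit from below. *)
apply: (@le_trans _ _ (einfs (fun n => (u n)%:E) N)).
  by apply: le_ereal_inf_tmp => _ [n /= Nn <-]; rewrite -EFinB lee_fin; exact: HN.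
rewrite (cvg_lim _ (ereal_nondecreasing_cvgn (nondecreasing_einfs _)))//.
by apply: ereal_sup_ubound; exists N.
Qed.

Lemma ratio_cvg1 (R : realType) (p : nat -> R) : valid p ->
  (forall e : R, 0 < e -> e < 1 -> \forall n \near \oo, (0 < n)%N /\
     (1 - e) * E_max_matching n (p n) <= E_greedy n (p n) /\
     0 < E_greedy n (p n)) ->
  greedy_ratio p n @[n --> \oo] --> (1 : R).
Proof.
move=> [p01 _] H; apply/cvgrPdist_le => e e0.
(* The minimum with one half meets the requirement of [H] that the tolerance be below 1. *)
have m0 : 0 < Num.min e 2^-1 by rewrite lt_min e0 invr_gt0 ltr0n.
have m1 : Num.min e 2^-1 < 1 by rewrite gt_min (_ : 2^-1 < 1 :> R) ?orbT//; lra.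
apply: filterS (H _ m0 m1) => n [n0 [ge G0]].
have GM := E_greedy_le_max n (p01 n n0).
have M0 := lt_le_trans G0 GM.
have r1 : greedy_ratio p n <= 1 by rewrite ler_pdivrMr// mul1r.
rewrite ger0_norm ?subr_ge0// lerBlDr -lerBlDl.
apply: (@le_trans _ _ (1 - Num.min e 2^-1)); last by rewrite ler_pdivlMr.
by rewrite lerD2l lerN2 ge_min lexx.
Qed.

Theorem theorem4 (R : realType) (p : nat -> R) (p_valid : valid p) :
  [/\ p =o_\oo (fun n : nat => (1 / n%:R)%R : R) ->
        greedy_ratio p n @[n --> \oo] --> (1 : R),
      forall c : R, 0 < c -> (\forall n \near \oo, p n = c / n%:R) ->
        (((c - ln (2 - expR (- c))) /
          (2 * c - (gamma_upp c + gamma_low c + gamma_upp c * gamma_low c)))%:E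
         <= limn_einf (fun n => (greedy_ratio p n)%:E))%E
    & (fun n : nat => (1 / n%:R)%R : R) =o_\oo p ->
        greedy_ratio p n @[n --> \oo] --> (1 : R)].
Proof.
have [p01 _] := p_valid.
have pos : \forall n \near \oo, (0 < n)%N by exists 1%N.
split=> [|c c0 pc|].
- move=> /eqoP/= po; apply: ratio_cvg1 => // e e0 e1.
  (* A quarter of [e] gives both [n%:R * p n <= 1] and [1 - 3 * (n%:R * p n) >= 1 - e]. *)
  have e4 : 0 < e / 4 by rewrite divr_gt0.
  apply: filterS2 pos (po _ e4) => n n0 pn.
  have nR : 0 < n%:R :> R by rewrite ltr0n.
  have pn01 := p01 n n0; have /andP[p0 p1] := pn01.
  have np : n%:R * p n <= e / 4.
    by move: pn; rewrite !gtr0_norm ?divr_gt0// mul1r ler_pdivlMr// mulrC.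
  have np1 : n%:R * p n <= 1 by lra.
  have G := E_greedy_ge_sparse n0 pn01 np1.
  have n2p : 0 < n%:R * n%:R * p n by rewrite !mulr_gt0.
  have G0 : 0 < E_greedy n (p n) by apply: lt_le_trans (G); rewrite mulr_gt0//; lra.
  have M0 := lt_le_trans G0 (E_greedy_le_max n pn01).
  split=> //; split=> //; apply: le_trans G; rewrite mulrC.
  by apply: ler_pM; rewrite ?E_max_le_edges ?(ltW M0)//; lra.
- have -> : (c - ln (2 - expR (- c))) /
      (2 * c - (gamma_upp c + gamma_low c + gamma_upp c * gamma_low c)) =
      greedy_density c / max_density c.
    by rewrite /greedy_density /max_density -mulf_div divff ?mulr1// invr_neq0// gt_eqF.
  have b0 : 0 < max_density c.
    exact: lt_le_trans (greedy_density_gt0 c0) (greedy_le_max_density c0).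
  apply: le_limn_einf => r rab.
  (* [greedy_ratio_lower] asks for [r > 0]; for other [r] the ratio being nonnegative suffices. *)
  have [r0|r0] := leP r 0.
    apply: filterS pos => n n0; apply: (le_trans r0).
    have pn01 := p01 n n0; have /andP[p0 p1] := pn01.
    have P0 g : 0 <= gnnp_prob (p n) g by apply: gnnp_prob_ge0; rewrite !ltW.
    apply: divr_ge0; apply: sumr_ge0 => g _; last exact: mulr_ge0.
    by apply: sumr_ge0 => m _; rewrite !mulr_ge0 ?greedy_prob_ge0.
  move: rab; rewrite ltr_pdivlMr// => rab.
  have [N HN] := greedy_ratio_lower c0 r0 rab.
  have Nn : \forall n \near \oo, (N <= n)%N by exists N.
  by apply: filterS2 pc Nn => n pn /HN; rewrite /greedy_ratio pn.
- move=> /eqoP/= po; apply: ratio_cvg1 => // e e0 e1.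
  apply: filterS2 pos (po _ e0) => n n0 pn.
  have nR : 0 < n%:R :> R by rewrite ltr0n.
  have pn01 := p01 n n0; have /andP[p0 p1] := pn01.
  (* The expected loss of greedy is at most a fraction [e] of the balls. *)
  have ip : (p n)^-1 <= e * n%:R.
    move: pn; rewrite !gtr0_norm ?divr_gt0// ler_pdivrMr// => pn.
    by rewrite -[leLHS]mul1r ler_pdivrMr// mulrAC.
  have G := E_greedy_ge_inv n0 pn01.
  have {}G : (1 - e) * n%:R <= E_greedy n (p n) by lra.
  split=> //; split; last by apply: lt_le_trans G; rewrite mulr_gt0//; lra.
  apply: le_trans G; rewrite ler_pM2l ?E_max_le_n//; lra.
Qed.
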